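(* Let $Q\subset\mathbb{C}$ be an unshielded continuum with finest map $\varphi$ onto a locally connected continuum, and let $X\subset Q$ be a continuum. If $X$ has a well-slicing family $\mathcal C$, then $\varphi(X)$ is not a point.
   Context: $Q$ is unshielded if $Q=\partial U_\infty$, $U_\infty$ the component of $\widehat{\mathbb{C}}\setminus Q$ containing $\infty$. Let $\Psi:\widehat{\mathbb{C}}\setminus\overline{\mathbb{D}}\to U_\infty$ be the Riemann map with $\Psi(\infty)=\infty$, $\Psi'(\infty)>0$. For an angle $\theta\in\mathbb{R}/\mathbb{Z}$: external ray $R_\theta=\Psi(\{re^{2\pi i\theta}:r>1\})$; principal set $\mathrm{acc}(\theta)$ = set of accumulation points of $\Psi(re^{2\pi i\theta})$ as $r\to1$; impression $\mathrm{imp}(\theta)$ = set of limits $\lim\Psi(z_i)$, $|z_i|>1$, $z_i\to e^{2\pi i\theta}$. The finest map $\varphi$ is the monotone surjection of $Q$ onto a locally connected continuum through which every other monotone surjection of $Q$ onto a locally connected continuum factors via a monotone map. A ray-compactum is a compactum $C\subset Q$ together with a closed set of angles $\Theta(C)$ such that $\bigcup_{\theta\in\Theta(C)}\mathrm{acc}(\theta)\subset C\subset\bigcup_{\theta\in\Theta(C)}\mathrm{imp}(\theta)$; set $\widetilde C=C\cup\bigcup_{\theta\in\Theta(C)}R_\theta$. $C$ ray-separates $A,B\subset Q$ if $\widetilde C$ separates $\overline{U_\infty}$ between $A$ and $B$ (i.e. $\overline{U_\infty}\setminus\widetilde C=U\cup V$ with $A\subset U$, $B\subset V$, $\overline U\cap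 V=U\cap\overline V=\emptyset$); $C$ ray-separates a continuum $X$ if it ray-separates two points of $X$. A well-slicing family for $X$ is a collection $\mathcal C$ of at least two pairwise disjoint ray-compacta in $Q$, each of which ray-separates $X$, such that any two distinct elements of $\mathcal C$ are ray-separated by a third element of $\mathcal C$. *)

(* Defs.v *)
(* The complex plane is modelled as  (R[i])^o  for an
   arbitrary  R : realType  (R[i] = complex numbers over R, from
   mathcomp-real-closed;  ^o  equips it with its canonical normed/topological
   structure as a normed module over itself). *)
From mathcomp Require Import all_boot all_order all_algebra.
From mathcomp Require Import all_classical all_reals all_analysis.
From mathcomp Require Import complex.
Import numFieldNormedType.Exports.

Set Implicit Arguments.
Unset Strict Implicit.
Unset Printing Implicit Defensive.
Import Order.TTheory GRing.Theory Num.Theory.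
Local Open Scope ring_scope.
Local Open Scope classical_set_scope.
Local Open Scope complex_scope.

Notation Cplx R := ((R[i])^o).

Section Plane.
Variable R : realType.
Implicit Types (Q C X A B Th : set (Cplx R)) (Psi : Cplx R -> Cplx R).

Definition plane_continuum X := [/\ X !=set0, compact X & connected X].

(* U_infty minus the point infinity: the unbounded component of C \ Q *)
Definition Uinf Q : set (Cplx R) :=
  [set z | (~` Q) z /\ ~ bounded_set (connected_component (~` Q) z)].

Definition unshielded Q :=
  Q = closure (Uinf Q) `\` interior (Uinf Q).

(* Psi is the Riemann map  C^ \ closed disk -> U_infty  with Psi(oo) = oo and
   Psi'(oo) > 0, i.e. Psi is holomorphic and bijective from {|z| > 1} onto
   U_infty \ {oo} and Psi(z)/z -> c for some real c > 0 as z -> oo. *)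
Definition riemann_map Q Psi :=
  [/\ (forall z : Cplx R, 1 < `|z| -> derivable Psi z 1),
      {in [set z : Cplx R | 1 < `|z|] &, injective Psi},
      Psi @` [set z : Cplx R | 1 < `|z|] = Uinf Q &
      exists c : R, 0 < c /\
        forall e : R, 0 < e -> exists M : R, forall z : Cplx R,
          M%:C < `|z| -> `|Psi z / z - c%:C| < e%:C].

(* Angles theta in R/Z are represented by the points w = e^{2 pi i theta}
   of the unit circle. *)
Definition unit_circle : set (Cplx R) := [set w | `|w| = 1].

Definition ext_ray Psi (w : Cplx R) : set (Cplx R) :=
  [set Psi (r%:C * w) | r in [set r : R | 1 < r]].

Definition acc_set Psi (w : Cplx R) : set (Cplx R) :=
  cluster ((fun r : R => Psi (r%:C * w)) @ (1:R)^'+).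

Definition impression Psi (w : Cplx R) : set (Cplx R) :=
  [set p | exists u : nat -> Cplx R, [/\ (forall n, 1 < `|u n|),
      u @ \oo --> w & (Psi \o u) @ \oo --> p]].

Definition ray_compactum Q Psi C Th :=
  [/\ compact C /\ C `<=` Q, closed Th /\ Th `<=` unit_circle,
      \bigcup_(w in Th) acc_set Psi w `<=` C &
      C `<=` \bigcup_(w in Th) impression Psi w].

Definition tilde Psi C Th : set (Cplx R) :=
  C `|` \bigcup_(w in Th) ext_ray Psi w.

Definition ray_separates Q Psi C Th A B :=
  exists U V : set (Cplx R),
    [/\ closure (Uinf Q) `\` tilde Psi C Th = U `|` V,
        A `<=` U, B `<=` V & separated U V].

Definition ray_separates_cont Q Psi C Th X :=
  exists x y, [/\ X x, X y & ray_separates Q Psi C Th [set x] [set y]].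

Definition well_slicing Q Psi X (F : set (set (Cplx R) * set (Cplx R))) :=
  [/\ (exists a b, [/\ F a, F b & a <> b]),
      (forall a, F a -> ray_compactum Q Psi a.1 a.2),
      (forall a b, F a -> F b -> a <> b -> a.1 `&` b.1 = set0),
      (forall a, F a -> ray_separates_cont Q Psi a.1 a.2 X) &
      (forall a b, F a -> F b -> a <> b ->
         exists c, [/\ F c, c <> a, c <> b & ray_separates Q Psi c.1 c.2 a.1 b.1])].

End Plane.

Definition locally_connected_space (T : topologicalType) :=
  forall (x : T) (N : set T), nbhs x N ->
    exists V : set T, [/\ open V, connected V, V x & V `<=` N].

Definition lc_continuum (T : topologicalType) :=
  [/\ hausdorff_space T, (setT : set T) !=set0, compact (setT : set T),
      connected (setT : set T) & locally_connected_space T].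

Definition monotone_on (S T : topologicalType) (A : set S) (f : S -> T) :=
  {within A, continuous f} /\ forall y : T, connected (A `&` f @^-1` [set y]).

Definition finest_map (S Y : topologicalType) (Q : set S) (phi : S -> Y) :=
  [/\ lc_continuum Y, monotone_on Q phi, phi @` Q = setT &
      forall (Z : topologicalType) (g : S -> Z),
        lc_continuum Z -> monotone_on Q g -> g @` Q = setT ->
        exists h : Y -> Z, monotone_on setT h /\ {in Q, forall x, g x = h (phi x)}].

(* Main.v *)
(* Each impression is mapped to a point by a suitable monotone map [g] of [Q]
   onto a locally connected continuum [Z] that does not collapse [X]; as [g]
   factors through the finest map, the latter does not collapse [X] either.

   Two distinct members of the family have disjoint sets of angles, since the
   principal set of a common angle would lie in both compacta.  Consequently,
   interpolating between two members again and again, as in Urysohn's lemma,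
   yields a continuous function [f] on [Q] which takes different values on the
   traces on [X] of two members (every member meets [X], by connectedness) and
   which is constant on impressions: an impression can only cross a member to
   which its own angle belongs, hence never two consecutive ones.

   [Z] is the quotient of [Q] by the components of the fibres of [f].
   Impressions are connected, so each of them is a point of [Z], and they depend
   upper semicontinuously on the angle; as they cover [Q], [Z] is a continuous
   image of the circle, hence locally connected.

   That impressions lie in [Q] and that [Psi] is bounded near the circle both
   rest on [Psi] (and [z |-> 1 / Psi (1 / z)]) being open.  Holomorphy is not
   needed for this: invariance of domain in the plane is derived from Sperner's
   lemma on a square grid. *)
Require Import Defs.
From HB Require Import structures.
From mathcomp Require Import all_boot all_order all_algebra.
From mathcomp Require Import all_classical all_reals all_analysis.
From mathcomp Require Import complex.
From mathcomp Require Import ring lra zify.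
Import numFieldNormedType.Exports.
Set Implicit Arguments.
Unset Strict Implicit.
Unset Printing Implicit Defensive.
Import Order.TTheory GRing.Theory Num.Theory ComplexField.Normc.
Local Open Scope ring_scope.
Local Open Scope classical_set_scope.
Local Open Scope complex_scope.

(** * The complex plane over a real type *)

Section Plane.
Variable R : realType.
Implicit Types (z w : Cplx R) (A : set (Cplx R)).

Lemma norm_normc z : `|z| = (normc z)%:C.
Proof. by []. Qed.

Lemma lt1_normc z : (1 < `|z|) = (1 < normc z).
Proof. by rewrite norm_normc -[1]/(1%:C) ltcR. Qed.

Lemma normc_ge0 z : 0 <= normc z.
Proof. by rewrite -lecR -norm_normc normr_ge0. Qed.

Lemma normc_distC z w : normc (z - w) = normc (w - z).
Proof. by rewrite -[LHS]normcN opprB. Qed.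

Lemma normc_distD z w v : normc (z - v) <= normc (z - w) + normc (w - v).
Proof. by rewrite (_ : z - v = (z - w) + (w - v)) ?le_normcD// addrA subrK. Qed.

Lemma normc_real (r : R) : normc r%:C = `|r|.
Proof. by rewrite /normc /= expr0n /= addr0 sqrtr_sqr. Qed.

Lemma Re_normc z : `|complex.Re z| <= normc z.
Proof.
case: z => a b /=; rewrite -[X in X <= _]sqrtr_sqr; apply: ler_wsqrtr.
by rewrite lerDl sqr_ge0.
Qed.

Lemma Im_normc z : `|complex.Im z| <= normc z.
Proof.
case: z => a b /=; rewrite -[X in X <= _]sqrtr_sqr; apply: ler_wsqrtr.
by rewrite lerDr sqr_ge0.
Qed.

Lemma normc_le_ReIm z : normc z <= `|complex.Re z| + `|complex.Im z|.
Proof.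
case: z => a b /=.
rewrite -[X in _ <= X]ger0_norm ?addr_ge0// -[X in _ <= X]sqrtr_sqr.
apply: ler_wsqrtr; rewrite sqrrD !real_normK ?num_real//.
by rewrite lerD2r lerDl mulrn_wge0// mulr_ge0.
Qed.

Lemma ReB z w : complex.Re (z - w) = complex.Re z - complex.Re w.
Proof. by case: z; case: w. Qed.

Lemma ImB z w : complex.Im (z - w) = complex.Im z - complex.Im w.
Proof. by case: z; case: w. Qed.

(** Balls of [Cplx R] have radii in [R[i]], but a positive element of [R[i]] has zero imaginary
    part, so real radii suffice. *)
Lemma nbhs_normcP z A :
  nbhs z A <-> exists2 e : R, 0 < e & forall w, normc (w - z) < e -> A w.
Proof.
split=> [/nbhs_ballP[e /= e0 zeA]|[e e0 eA]].
  have e0' : 0 < complex.Re e by move: e0; rewrite ltcE => /andP[_].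
  have Ee : e = (complex.Re e)%:C.
    by move: e0; rewrite ltcE => /andP[/eqP Ie _]; case: e Ie {e0' zeA} => a b /= ->.
  exists (complex.Re e) => // w wz; apply: zeA.
  by rewrite -ball_normE /ball_ /= norm_normc Ee ltcR normc_distC.
apply/nbhs_ballP; exists e%:C; first by rewrite /= ltcR.
move=> w; rewrite -ball_normE /ball_ /= norm_normc ltcR normc_distC; exact: eA.
Qed.

Lemma near_normc z (e : R) : 0 < e -> \forall w \near z, normc (w - z) < e.
Proof. by move=> e0; apply/nbhs_normcP; exists e. Qed.

Lemma lipschitz_continuous (f : Cplx R -> R) :
  (forall z w, `|f z - f w| <= normc (z - w)) -> continuous f.
Proof.
move=> fl z A /nbhs_ballP[e /= e0 eA]; apply/nbhs_normcP; exists e => // w wz.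
by apply: eA; apply: le_lt_trans (fl _ _) _; rewrite normc_distC.
Qed.

Lemma normc_continuous : continuous (@normc R : Cplx R -> R).
Proof.
apply: lipschitz_continuous => z w; rewrite ler_norml.
have := normc_distD z w 0; have := normc_distD w z 0; rewrite !subr0 normc_distC => h1 h2.
by apply/andP; split; lra.
Qed.

Lemma cvg_complexP (U : Type) (F : set_system U) (FF : Filter F) (f : U -> Cplx R) z :
  (forall e : R, 0 < e -> \forall x \near F, normc (f x - z) < e) -> f @ F --> z.
Proof.
move=> fz A /nbhs_normcP[e e0 eA]; have := fz e e0.
by apply: filterS => x; exact: eA.
Qed.

Lemma Complex_continuous : continuous (fun p : R * R => (p.1 +i* p.2 : Cplx R)).
Proof.
move=> [a b]; apply: cvg_complexP => e e0.
have e20 : 0 < e / 2 by rewrite divr_gt0.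
exists ([set x | `|x - a| < e / 2], [set y | `|y - b| < e / 2]).
  split; rewrite /=.
    by apply/nbhs_ballP; exists (e / 2) => // x; rewrite /ball /= distrC.
  by apply/nbhs_ballP; exists (e / 2) => // x; rewrite /ball /= distrC.
move=> [x y] [/= xa yb].
change (normc ((x +i* y : Cplx R) - (a +i* b)) < e).
apply: le_lt_trans (normc_le_ReIm _) _.
by rewrite ReB ImB /= (splitr e) ltrD.
Qed.

Lemma compact_disc (M : R) : compact [set z : Cplx R | normc z <= M].
Proof.
apply: (@subclosed_compact _ _
    ((fun p : R * R => (p.1 +i* p.2 : Cplx R)) @` (`[-M, M] `*` `[-M, M]))).
- rewrite (_ : [set z | _] = (@normc R : Cplx R -> R) @^-1` [set x | x <= M])//.
  by apply: closed_comp => [? _|]; [exact: normc_continuous|exact: closed_le].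
- apply: continuous_compact; last by apply: compact_setX; exact: segment_compact.
  exact: continuous_subspaceT Complex_continuous.
- move=> [a b] /= zM; exists (a, b) => //.
  have := Re_normc (a +i* b : Cplx R); have := Im_normc (a +i* b : Cplx R) => /= h1 h2.
  by split; rewrite /= in_itv /= -ler_norml; apply: le_trans zM.
Qed.

Lemma Cplx_hausdorff : hausdorff_space (Cplx R).
Proof. exact: norm_hausdorff. Qed.

End Plane.

(** * Sperner's lemma and invariance of domain *)

(** Signed passage from [Some false] to [Some true]: a cochain on edges, closed on every triangle
    that misses one of the three labels. *)
Definition crossing (a b : option bool) : int :=
  match a, b with
  | Some false, Some true => 1
  | Some true, Some false => -1
  | _, _ => 0
  end.

Lemma crossing_cocycle a b c : ~~ uniq [:: a; b; c] ->
  crossing a b + crossing b c = crossing a c.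
Proof. by case: a => [[]|]; case: b => [[]|]; case: c => [[]|]. Qed.

(** The total crossing is the same along all rows, since triangles are closed and the left and right
    sides carry none. It is 0 at the bottom, where all labels are [None], and 1 at the top, which
    leads from [Some false] to [Some true] and avoids [None]. *)
Lemma sperner_square n (lab : nat -> nat -> option bool) :
  (forall i j, (i < n)%N -> (j < n)%N ->
     ~~ uniq [:: lab i j; lab i.+1 j; lab i.+1 j.+1] /\
     ~~ uniq [:: lab i j; lab i j.+1; lab i.+1 j.+1]) ->
  (forall i, (i <= n)%N -> lab i 0%N = None) ->
  (forall i, (i <= n)%N -> lab i n != None) ->
  (forall j, (j <= n)%N -> lab 0%N j != Some true) ->
  (forall j, (j <= n)%N -> lab n j != Some false) -> False.
Proof.
move=> tri bot top left right.
pose S m j := \sum_(0 <= i < m) crossing (lab i j) (lab i.+1 j).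
(* The two paths around the strip between rows [j] and [j.+1], up to column [m], have the same
   crossing. *)
have Srow j m : (j < n)%N -> (m <= n)%N ->
    S m j + crossing (lab m j) (lab m j.+1) =
    crossing (lab 0%N j) (lab 0%N j.+1) + S m j.+1.
  move=> jn; elim: m => [|m IH] mn; first by rewrite /S !big_nil add0r addr0.
  have [/crossing_cocycle t1 /crossing_cocycle t2] := tri m j mn jn.
  have := IH (ltnW mn); rewrite /S !big_nat_recr//= => IH'.
  by rewrite addrA -IH' -!addrA t1 t2.
have Sj j : (j <= n)%N -> S n j = S n 0%N.
  elim: j => [//|j IH] jn; rewrite -IH; last exact: ltnW.
  have := Srow j n jn (leqnn n).
  have -> : crossing (lab n j) (lab n j.+1) = 0.
    by move: (right j (ltnW jn)) (right _ jn); case: (lab n j) => [[]|];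
      case: (lab n j.+1) => [[]|].
  have -> : crossing (lab 0%N j) (lab 0%N j.+1) = 0.
    by move: (left j (ltnW jn)) (left _ jn); case: (lab 0%N j) => [[]|];
      case: (lab 0%N j.+1) => [[]|].
  by rewrite addr0 add0r.
have S0 : S n 0%N = 0.
  by rewrite /S big_nat big1// => i /andP[_ ?]; rewrite !bot// ltnW.
have Sn m : (m <= n)%N -> S m n = (lab m n == Some true)%:R.
  elim: m => [|m IH] mn.
    by rewrite /S big_nil; move: (left n (leqnn n)); case: (lab 0%N n) => [[]|].
  have := IH (ltnW mn); rewrite /S big_nat_recr//= => ->.
  by move: (top _ (ltnW mn)) (top _ mn); case: (lab m n) => [[]|];
    case: (lab m.+1 n) => [[]|].
have := Sn n (leqnn n); rewrite Sj// S0.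
by move: (top _ (leqnn n)) (right _ (leqnn n)); case: (lab n n) => [[]|].
Qed.

Lemma uniq3_rot (A : eqType) (a b c : A) : uniq [:: b; c; a] = uniq [:: a; b; c].
Proof. by rewrite -(rot_uniq 1 [:: a; b; c]). Qed.

(** * Rounding, moduli on compact sets, quadrants *)

Section Quadrants.
Variable R : realType.
Implicit Types (z w : Cplx R).

(** The shift by [2^-1] rounds [N * t] to the nearest integer. Pairwise the rounded values differ by
    at most one, so they are at most two, which settles the case of a common sign. If signs differ,
    all [t] are near the same end of [[-1, 1]]; a rounding cell is centred there, so only the sign
    can vary. *)
Lemma uniq_floor_sign (N : nat) (t : 'I_3 -> R) (b : 'I_3 -> bool) :
  (0 < N)%N -> (forall i, `|t i| <= 1) ->
  (forall i j, `|t i - t j| < (2 * N%:R)^-1) ->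
  (forall i j, b i != b j -> forall k, 1 - (2 * N%:R)^-1 < `|t k|) ->
  ~~ uniq [seq (Num.floor (N%:R * t i + 2^-1), b i) | i <- [:: inord 0; inord 1; inord 2]].
Proof.
move=> N0 t1 tt tb.
have N0' : 0 < N%:R :> R by rewrite ltr0n.
have NV : N%:R * (2 * N%:R)^-1 = 2^-1 :> R by rewrite invfM mulrCA mulfV ?mulr1// gt_eqF.
pose F i := Num.floor (N%:R * t i + 2^-1).
have Flo i : (F i)%:~R <= N%:R * t i + 2^-1 by exact: Num.Theory.floor_le.
have Fhi i : N%:R * t i + 2^-1 < (F i)%:~R + 1.
  by have := Num.Theory.floorD1_gt (N%:R * t i + 2^-1); rewrite intrD.
have tt' i j : `|N%:R * t i - N%:R * t j| < 2^-1.
  by rewrite -mulrBr normrM ger0_norm ?ler0n// -NV ltr_pM2l.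
have FF i j : F i <= F j + 1.
  rewrite -ltzD1 -(ltr_int R) !intrD.
  have := tt' i j; rewrite ltr_norml => /andP[? ?].
  by have := Flo i; have := Fhi j; lra.
set i0 : 'I_3 := inord 0; set i1 : 'I_3 := inord 1; set i2 : 'I_3 := inord 2.
rewrite /= !inE !xpair_eqE -!/(F _).
have [bb|] := boolP ((b i0 == b i1) && (b i1 == b i2)).
  move: bb => /andP[/eqP -> /eqP ->]; rewrite eqxx !andbT.
  have := FF i0 i1; have := FF i1 i0; have := FF i0 i2; have := FF i2 i0.
  by have := FF i1 i2; have := FF i2 i1; lia.
move=> bb; have tbig k : 1 - (2 * N%:R)^-1 < `|t k|.
  by move: bb; rewrite negb_and => /orP[] /tb; exact.
have Fpm : (forall k, F k = N%:Z) \/ (forall k, F k = - N%:Z).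
  have tN k : N%:R - 2^-1 < `|N%:R * t k|.
    by rewrite normrM ger0_norm ?ler0n// -NV -[X in X - _]mulr1 -mulrBr ltr_pM2l.
  have tN1 k : `|N%:R * t k| <= N%:R.
    by rewrite normrM ger0_norm ?ler0n// ler_piMr.
  have N1 : 1 <= N%:R :> R by rewrite ler1n.
  have [t0|t0] := lerP 0 (t i0); [left|right] => k; apply: Num.Theory.floor_def.
    have a0 : 0 <= N%:R * t i0 by rewrite mulr_ge0.
    have := tN i0; rewrite ger0_norm// => b0.
    have := tt' i0 k; rewrite ltr_norml => /andP[c0 c1].
    have := tN k; rewrite ger0_norm; last lra.
    have := tN1 k; rewrite ger0_norm; last lra.
    by rewrite intrD => d0 d1; apply/andP; split; rewrite -?pmulrn; lra.
  have a0 : N%:R * t i0 < 0 by rewrite pmulr_rlt0.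
  have := tN i0; rewrite ltr0_norm// => b0.
  have := tt' i0 k; rewrite ltr_norml => /andP[c0 c1].
  have := tN k; rewrite ltr0_norm; last lra.
  have := tN1 k; rewrite ltr0_norm; last lra.
  by rewrite intrD mulrNz => d0 d1; apply/andP; split; rewrite -?pmulrn; lra.
by case: Fpm => FE; rewrite !FE eqxx; case: (b i0) (b i1) (b i2) => [] [] [].
Qed.

(** Near each point of [K], either [q < tau] or [p] stays above a positive constant; compactness
    makes the constant uniform. *)
Lemma compact_modulus (U : topologicalType) (K : set U) (p q : U -> R) (tau : R) :
  compact K -> (forall x, K x -> {for x, continuous p}) ->
  (forall x, K x -> {for x, continuous q}) ->
  (forall x, K x -> p x <= 0 -> q x < tau) ->
  exists2 eta, 0 < eta & forall x, K x -> p x < eta -> q x < tau.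
Proof.
move=> /compact_near_coveringP cK cp cq pq.
have [] // := cK R (0^'+)%classic (fun eta x => p x < eta -> q x < tau).
  move=> x Kx; have [p0|p0] := lerP (p x) 0.
    exists ([set x' | q x' < tau], setT); last by move=> -[x' eta] [/= ? _] _.
    split; last exact: filterT.
    exact: (cq x Kx _ (lt_nbhsl (pq _ Kx p0))).
  exists ([set x' | p x / 2 < p x'], [set eta | eta < p x / 2]).
    have p2 : p x / 2 < p x by rewrite ltr_pdivrMr//; lra.
    split; first exact: (cp x Kx _ (lt_nbhsr p2)).
    by apply: nbhs_right_lt; rewrite divr_gt0.
  by move=> -[x' eta] /= [h1 h2] h3; have := lt_trans (lt_trans h1 h3) h2; rewrite ltxx.
move=> e /= e0 h; exists (e / 2); first by rewrite divr_gt0.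
move=> x Kx; apply: h Kx => //=; last by rewrite divr_gt0.
by rewrite sub0r normrN ger0_norm ?ltW ?divr_gt0// ltr_pdivrMr//; lra.
Qed.

(** For [g = id] this is uniform continuity of [h]; for [h = id] and [g] injective, uniform
    continuity of the inverse of [g]. *)
Lemma compact_transfer (D : set (Cplx R)) (g h : Cplx R -> Cplx R) (tau : R) :
  compact D -> (forall z, D z -> {for z, continuous g}) ->
  (forall z, D z -> {for z, continuous h}) ->
  (forall z w, D z -> D w -> g z = g w -> h z = h w) -> 0 < tau ->
  exists2 eta, 0 < eta &
    forall z w, D z -> D w -> normc (g z - g w) < eta -> normc (h z - h w) < tau.
Proof.
move=> cD cg ch gh tau0.
have cdist (k : Cplx R -> Cplx R) : (forall z, D z -> {for z, continuous k}) ->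
    forall p, (D `*` D) p -> {for p, continuous (fun p : Cplx R * Cplx R =>
      normc (k p.1 - k p.2) : R)}.
  move=> ck [z w] [/= Dz Dw].
  apply: (@continuous_comp _ _ _ (fun p : Cplx R * Cplx R => k p.1 - k p.2)
    (@normc R : Cplx R -> R)); last exact: normc_continuous.
  by apply: cvgB; apply: cvg_comp; [exact: cvg_fst|exact: ck|exact: cvg_snd|exact: ck].
have [|eta eta0 H] := @compact_modulus _ _ _ _ tau (compact_setX cD cD) (cdist g cg) (cdist h ch).
  move=> [z w] [/= Dz Dw] gzw; have -> : h z = h w.
    apply: gh => //; apply/eqP; rewrite -subr_eq0; apply/eqP/eq0_normc/le_anti.
    by rewrite gzw normc_ge0.
  by rewrite subrr normc0.
by exists eta => // z w Dz Dw; exact: (H (z, w)).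
Qed.

(* [None] is the whole lower half-plane. *)
Definition quadrant z : option bool :=
  if complex.Im z < 0 then None else Some (0 <= complex.Re z).

(** The three regions meet only at the origin: with three different labels, both coordinates change
    sign on the triple, hence are small. *)
Lemma quadrant_near z w v (rho : R) : normc (z - w) < rho -> normc (w - v) < rho ->
  normc (z - v) < rho -> uniq [:: quadrant z; quadrant w; quadrant v] ->
  normc z <= 3 * rho.
Proof.
move=> zw wv zv; rewrite /quadrant => U.
apply: le_trans (normc_le_ReIm _) _; move: U.
have := le_lt_trans (Re_normc _) zw; have := le_lt_trans (Im_normc _) zw.
have := le_lt_trans (Re_normc _) wv; have := le_lt_trans (Im_normc _) wv.
have := le_lt_trans (Re_normc _) zv; have := le_lt_trans (Im_normc _) zv.
rewrite !ReB !ImB !ltr_norml.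
move=> /andP[a1 a2] /andP[a3 a4] /andP[a5 a6] /andP[a7 a8] /andP[a9 a10] /andP[a11 a12].
have [r0|r0] := lerP 0 (complex.Re z); have [i0|i0] := lerP 0 (complex.Im z);
  have [r1|r1] := lerP 0 (complex.Re w); have [i1|i1] := lerP 0 (complex.Im w);
  have [r2|r2] := lerP 0 (complex.Re v); have [i2|i2] := lerP 0 (complex.Im v) => //= _;
  by rewrite ?(ger0_norm r0) ?(ltr0_norm r0) ?(ger0_norm i0) ?(ltr0_norm i0); lra.
Qed.

End Quadrants.

(** * Taxicab circles and hues *)

Section Hues.
Variable R : realType.
Implicit Types (z w y : Cplx R).

Definition taxi y : R := `|complex.Re y| + `|complex.Im y|.

Lemma taxi_lipschitz y z : `|taxi y - taxi z| <= 2 * normc (y - z).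
Proof.
have := Re_normc (y - z); have := Im_normc (y - z); rewrite ReB ImB /taxi => h1 h2.
have := ler_dist_dist (complex.Re y) (complex.Re z).
have := ler_dist_dist (complex.Im y) (complex.Im z); rewrite !ler_norml => /andP[? ?] /andP[? ?].
by apply/andP; split; lra.
Qed.

Lemma normc_le_taxi y : normc y <= taxi y.
Proof. exact: normc_le_ReIm. Qed.

Lemma taxi_le_normc y : taxi y <= 2 * normc y.
Proof. by have := Re_normc y; have := Im_normc y; rewrite /taxi; lra. Qed.

(* The position of [y] on the taxicab circle through [y], up to [1/N]. *)
Definition hue (N : nat) y : int * bool :=
  (Num.floor (N%:R * (complex.Re y / taxi y) + 2^-1), 0 <= complex.Im y).

Lemma Re_div_taxi y : `|complex.Re y / taxi y| <= 1.
Proof.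
rewrite normrM normfV [X in _ / X]ger0_norm ?addr_ge0//.
have [t0|t0] := lerP (taxi y) 0.
  have -> : taxi y = 0 by apply/le_anti; rewrite t0 addr_ge0.
  by rewrite invr0 mulr0.
by rewrite ler_pdivrMr// mul1r lerDl.
Qed.

Lemma Re_taxi y : 0 < taxi y -> taxi y * (complex.Re y / taxi y) = complex.Re y.
Proof. by move=> t0; rewrite mulrC divfK// gt_eqF. Qed.

(** An instance of [uniq_floor_sign]: where [Im] changes sign between close points it is small, and
    then [Re / taxi] is close to 1 or -1. *)
Lemma hue_uniq (N : nat) (mu : R) (y : 'I_3 -> Cplx R) : (0 < N)%N -> 0 < mu ->
  (forall i, mu <= taxi (y i)) ->
  (forall i j, normc (y i - y j) < mu / (8 * N%:R)) ->
  ~~ uniq [seq hue N (y i) | i <- [:: inord 0; inord 1; inord 2]].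
Proof.
move=> N0 mu0 ymu yy; pose s i := taxi (y i).
have N0' : 0 < N%:R :> R by rewrite ltr0n.
pose a : R := (2 * N%:R)^-1.
have a0 : 0 < a by rewrite invr_gt0 mulr_gt0.
(* Distances are below [mu * a / 4]; [Re] moves by at most one such amount and [taxi] by at most
   two, so [Re / taxi] moves by less than [a]. *)
have bE : mu / (8 * N%:R) = mu * a / 4 by rewrite /a; field; rewrite gt_eqF.
have s0 i : 0 < s i by apply: lt_le_trans (ymu i).
apply: (uniq_floor_sign (t := fun i => complex.Re (y i) / s i)
    (b := fun i => 0 <= complex.Im (y i))) => //.
- by move=> i; exact: Re_div_taxi.
- move=> i j; rewrite -/a.
  have hR := le_lt_trans (Re_normc _) (yy i j); rewrite ReB bE in hR.
  have hI := taxi_lipschitz (y i) (y j).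
  have hn := yy i j; rewrite bE in hn.
  have -> : complex.Re (y i) / s i - complex.Re (y j) / s j =
      ((complex.Re (y i) - complex.Re (y j))
        + (complex.Re (y j) / s j) * (s j - s i)) / s i.
    by field; rewrite !gt_eqF.
  rewrite normrM normfV (gtr0_norm (s0 i)) ltr_pdivrMr//.
  apply: le_lt_trans (ler_normD _ _) _; rewrite normrM.
  have h1 : `|complex.Re (y j) / s j| * `|s j - s i| <= `|s i - s j|.
    by rewrite [X in _ <= X]distrC ler_piMl// Re_div_taxi.
  have h2 : mu * a <= a * s i by rewrite mulrC ler_pM2l ?ymu.
  have h3 : 0 < mu * a by rewrite mulr_gt0.
  by move: hI; rewrite -/(s i) -/(s j) => hI; lra.
- move=> i j bij k; rewrite -/a.
  have hI l m := le_lt_trans (Im_normc _) (yy l m).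
  have Ik : `|complex.Im (y k)| < mu * a / 2.
    have := hI i j; have := hI i k; have := hI j k; rewrite !ImB bE !ltr_norml.
    move=> /andP[h1 h2] /andP[h3 h4] /andP[h5 h6].
    have h7 : 0 < mu * a by rewrite mulr_gt0.
    move: bij; have [?|?] := lerP 0 (complex.Im (y i));
      have [?|?] := lerP 0 (complex.Im (y j)) => //= _; apply/andP; split; lra.
  rewrite normrM normfV (gtr0_norm (s0 k)) ltr_pdivlMr//.
  have := ymu k; rewrite -/(s k) => h.
  have h2 : mu * a <= a * s k by rewrite mulrC ler_pM2l.
  have -> : `|complex.Re (y k)| = s k - `|complex.Im (y k)|.
    by rewrite /s /taxi addrK.
  have h7 : 0 < mu * a by rewrite mulr_gt0.
  by lra.
Qed.

(** Equal hues put the ratios [Re / taxi] within [1 / N]; with [taxi] almost known this determines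
    [Re], and then [Im] from [taxi - |Re|] and its sign. *)
Lemma hue_close (N : nat) (s0 eta : R) y z : (0 < N)%N -> hue N y = hue N z ->
  0 < taxi y -> 0 < taxi z -> `|taxi y - s0| < eta -> `|taxi z - s0| < eta ->
  normc (y - z) <= 2 * (s0 + eta) / N%:R + 6 * eta.
Proof.
move=> N0 [hf hs] y0 z0 ys zs.
have N0' : 0 < N%:R :> R by rewrite ltr0n.
set t := complex.Re y / taxi y in hf; set u := complex.Re z / taxi z in hf.
have tu : `|t - u| <= N%:R^-1.
  have a1 := Num.Theory.floor_le (N%:R * t + 2^-1).
  have a2 := Num.Theory.floorD1_gt (N%:R * t + 2^-1).
  have b1 := Num.Theory.floor_le (N%:R * u + 2^-1).
  have b2 := Num.Theory.floorD1_gt (N%:R * u + 2^-1).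
  rewrite hf !intrD in a1 a2 b1 b2.
  have : `|N%:R * t - N%:R * u| <= 1 by rewrite ler_norml; apply/andP; split; lra.
  by rewrite -mulrBr normrM (gtr0_norm N0') mulrC -ler_pdivlMr// div1r.
have st : `|taxi y * (t - u)| <= (s0 + eta) / N%:R.
  rewrite normrM; apply: ler_pM => //; rewrite gtr0_norm//.
  by move: ys; rewrite ltr_norml => /andP[_ ?]; lra.
have su : `|(taxi y - taxi z) * u| <= 2 * eta.
  rewrite normrM; apply: le_trans (_ : `|taxi y - taxi z| <= _).
    by rewrite ler_piMr// Re_div_taxi.
  by move: ys zs; rewrite !ltr_norml ler_norml => /andP[? ?] /andP[? ?]; apply/andP; split; lra.
have dR : `|complex.Re y - complex.Re z| <= (s0 + eta) / N%:R + 2 * eta.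
  have -> : complex.Re y - complex.Re z = taxi y * (t - u) + (taxi y - taxi z) * u.
    by rewrite -{1}(Re_taxi y0) -{1}(Re_taxi z0) -/t -/u; ring.
  by apply: le_trans (ler_normD _ _) _; exact: lerD.
have dI : `|complex.Im y - complex.Im z| <= (s0 + eta) / N%:R + 4 * eta.
  have -> : `|complex.Im y - complex.Im z| = `| `|complex.Im y| - `|complex.Im z| |.
    move: hs; have [h1|h1] := lerP 0 (complex.Im y); have [h2|h2] := lerP 0 (complex.Im z) => //= _.
      by rewrite (ger0_norm h1) (ger0_norm h2).
    by rewrite (ltr0_norm h1) (ltr0_norm h2) -[RHS]normrN; congr (`|_|); ring.
  have -> : `|complex.Im y| - `|complex.Im z| =
      (taxi y - taxi z) - (`|complex.Re y| - `|complex.Re z|).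
    by rewrite /taxi; ring.
  have := le_trans (ler_dist_dist (complex.Re y) (complex.Re z)) dR.
  move: ys zs; rewrite !ltr_norml !ler_norml => /andP[? ?] /andP[? ?] /andP[? ?].
  by apply/andP; split; lra.
apply: le_trans (normc_le_ReIm _) _; rewrite ReB ImB.
by rewrite -mulrA; lra.
Qed.

Definition square z (e : R) : set (Cplx R) :=
  [set w | `|complex.Re (w - z)| <= e /\ `|complex.Im (w - z)| <= e].

Lemma compact_square z (e : R) : compact (square z e).
Proof.
apply: (subclosed_compact _ (@compact_disc R (2 * e + normc z))); last first.
  move=> w [wR wI] /=; have := normc_distD w z 0; rewrite !subr0 => h.
  by have := normc_le_ReIm (w - z); lra.
apply: closedI.
  apply: (@closed_comp _ _ (fun w => `|complex.Re (w - z)|) [set x | x <= e]); last exact: closed_le.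
  move=> w _; apply: lipschitz_continuous => {}w v; apply: le_trans (ler_dist_dist _ _) _.
  by rewrite -ReB opprB addrA subrK Re_normc.
apply: (@closed_comp _ _ (fun w => `|complex.Im (w - z)|) [set x | x <= e]); last exact: closed_le.
move=> w _; apply: lipschitz_continuous => {}w v; apply: le_trans (ler_dist_dist _ _) _.
by rewrite -ImB opprB addrA subrK Im_normc.
Qed.

End Hues.

Section InvarianceOfDomain.
Variable R : realType.
Implicit Types (z w y : Cplx R).

(* Suppose that [c] is close to [f z0] but not a value.  Label the points [x] of
   a fine grid by the quadrant of [x - z0] when [f x] is far from [c], and by a
   label of the hue of [f x - c] otherwise; the label of a hue is the quadrant
   of a point of that hue on the frontier between the two regions, if any.  By
   [hue_uniq] three neighbouring points never have three hues, and [z0], the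
   only point where the quadrants meet, is in the second region, so that no
   triangle carries three labels, against Sperner's lemma. *)
Lemma invariance_of_domain (f : Cplx R -> Cplx R) z0 (e : R) : 0 < e ->
  (forall z, square z0 e z -> {for z, continuous f}) ->
  (forall z w, square z0 e z -> square z0 e w -> f z = f w -> z = w) ->
  exists2 eta, 0 < eta & forall y, normc (y - f z0) < eta ->
    exists2 z, square z0 e z & f z = y.
Proof.
move=> e0 cf injf; set D := square z0 e in cf injf *.
have cD : compact D by exact: compact_square.
have Dz0 : D z0 by split; rewrite subrr normr0 ltW.
have cid (z : Cplx R) : D z -> {for z, continuous (id : Cplx R -> Cplx R)} by move=> _; exact: cvg_id.
(* Modulus of the inverse of [f]: points at distance at least [e] from [z0] have images at distance
   at least [r] from [f z0]. *)
have [r r0 fr] := compact_transfer cD cf cid injf e0.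
have r80 : 0 < r / 8 by rewrite divr_gt0.
have [d d0 fd] := compact_transfer cD cid cf (fun z w _ _ zw => congr1 f zw) r80.
exists (r / 8) => //.
move=> c cz0; apply: contrapT => cD'.
have fc x : D x -> f x <> c by move=> Dx fxc; apply: cD'; exists x.
have [mu mu0 fmu] : exists2 mu, 0 < mu & forall x, D x -> mu <= normc (f x - c).
  have [|||mu mu0 fmu] := @compact_modulus R _ D (fun x => normc (f x - c)) (cst 1) 0 cD.
  - move=> x Dx; apply: (@continuous_comp _ _ _ (fun x => f x - c) (@normc R : Cplx R -> R)).
      exact: (cvgB (cf _ Dx) (cvg_cst c)).
    exact: normc_continuous.
  - by move=> x _; exact: cst_continuous.
  - move=> x Dx h; exfalso; apply: (fc x Dx); apply/eqP; rewrite -subr_eq0.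
    by apply/eqP/eq0_normc/le_anti; rewrite h normc_ge0.
  by exists mu => // x Dx; rewrite leNgt; apply/negP => /(fmu x Dx); rewrite ltr10.
(* The second region is [s < s0]. By [s_near] and [s_far] it contains all points of the square close
   to [z0] and misses the sides of the square. *)
pose s x := taxi (f x - c); pose s0 := r / 2.
have s00 : 0 < s0 by rewrite divr_gt0.
have s_mu x : D x -> mu <= s x.
  by move=> /fmu h; apply: le_trans h _; exact: normc_le_taxi.
have s_gt0 x : D x -> 0 < s x by move=> /s_mu; exact: lt_le_trans.
have s_near x : D x -> normc (x - z0) < d -> s x < s0.
  move=> Dx /(fd _ _ Dx Dz0) /= h.
  have := taxi_le_normc (f x - c); have := normc_distD (f x) (f z0) c.
  by rewrite (normc_distC (f z0)) /s /s0; lra.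
have s_far x : D x -> e <= normc (x - z0) -> s0 <= s x.
  move=> Dx ex; have : ~ (normc (f x - f z0) < r).
    by move=> /(fr _ _ Dx Dz0) /=; rewrite ltNge ex.
  move=> /negP; rewrite -leNgt => h.
  have := normc_le_taxi (f x - c); have := normc_distD (f x) c (f z0).
  by rewrite /s /s0; lra.
pose tau := d / 12; have tau0 : 0 < tau by rewrite divr_gt0.
have [r2 r20 fr2] := compact_transfer cD cf cid injf tau0.
pose eta := Num.min s0 (r2 / 16).
have eta0 : 0 < eta by rewrite lt_min s00 divr_gt0.
(* By [hue_close], points of equal hue with [s] within [eta] of [s0] then have images closer than
   [r2], so they are themselves closer than [tau]. *)
have [N N0 HN] : exists2 N, (0 < N)%N & 2 * (s0 + eta) / N%:R + 6 * eta < r2.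
  exists (Num.trunc (8 * s0 / r2)).+1 => //.
  have := truncnS_gt (8 * s0 / r2); set n := (Num.trunc _).+1 => h.
  have n0 : 0 < n%:R :> R by rewrite ltr0n.
  have a1 : eta <= s0 by rewrite ge_min lexx.
  have a2 : eta <= r2 / 16 by rewrite ge_min lexx orbT.
  rewrite ltr_pdivrMr// in h.
  have a3 : 2 * (s0 + eta) / n%:R < r2 / 2 by rewrite ltr_pdivrMr//; lra.
  by lra.
(* The first bound serves [hue_uniq]; the second makes [s] vary by less than [eta] along an edge. *)
pose beta := Num.min (mu / (8 * N%:R)) (eta / 3).
have beta0 : 0 < beta by rewrite lt_min !divr_gt0// mulr_gt0// ltr0n.
have [m1 m10 fm] := compact_transfer cD cid cf (fun z w _ _ zw => congr1 f zw) beta0.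
pose m := Num.min m1 tau; have m0 : 0 < m by rewrite lt_min m10.
have [l lP] : exists l : int * bool -> option bool,
    forall x, D x -> `|s x - s0| < eta -> exists x', [/\ D x',
      hue N (f x' - c) = hue N (f x - c), `|s x' - s0| < eta &
      l (hue N (f x - c)) = quadrant (x' - z0)].
  pose P (k : int * bool) (o : option bool) := forall x, D x -> `|s x - s0| < eta ->
    hue N (f x - c) = k -> exists x', [/\ D x', hue N (f x' - c) = k,
      `|s x' - s0| < eta & o = quadrant (x' - z0)].
  have [|l lP] := @choice _ _ P.
    move=> k.
    have [[x [Dx xs xk]]|nx] := pselect (exists x, [/\ D x, `|s x - s0| < eta &
        hue N (f x - c) = k]).
      by exists (quadrant (x - z0)) => x2 _ _ _; exists x.
    by exists None => x Dx xs xk; exfalso; apply: nx; exists x.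
  by exists l => x Dx xs; exact: lP (erefl _).
pose lab x := if s0 <= s x then quadrant (x - z0) else l (hue N (f x - c)).
have tri (x : 'I_3 -> Cplx R) : (forall i, D (x i)) ->
    (forall i j, normc (x i - x j) < m) ->
    ~~ uniq [seq lab (x i) | i <- [:: inord 0; inord 1; inord 2]].
  move=> Dx xm.
  have fxm i j : normc (f (x i) - f (x j)) < beta.
    by apply: fm => //; apply: lt_le_trans (xm i j) _; rewrite ge_min lexx.
  have [[i xi]|nA] := pselect (exists i, s0 <= s (x i)); last first.
    have -> : [seq lab (x i) | i <- [:: inord 0; inord 1; inord 2]] =
        map l [seq hue N (f (x i) - c) | i <- [:: inord 0; inord 1; inord 2]].
      rewrite -map_comp; apply: eq_map => i /=; rewrite /lab ifF//.
      by apply/negP => h; apply: nA; exists i.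
    apply: contra (@hue_uniq R N mu (fun i => f (x i) - c) N0 mu0 _ _) => [/map_uniq//||].
      by move=> k; exact: s_mu.
    move=> j k; rewrite opprB addrA subrK; apply: lt_le_trans (fxm j k) _.
    by rewrite ge_min lexx.
  (* One vertex is in the first region, so the vertices in the second have [s] close to [s0]. Every
     label is thus the quadrant of a point [y k] close to [x k]: [x k] itself, or the point chosen
     for its hue. *)
  have /choice[y yP] : forall k, exists y, [/\ normc (y - x k) < tau,
      lab (x k) = quadrant (y - z0) & s0 <= s (x k) -> y = x k].
    move=> k; rewrite /lab; case: (lerP s0 (s (x k))) => hk.
      by exists (x k); split => //; rewrite subrr normc0.
    have sk : `|s (x k) - s0| < eta.
      have := taxi_lipschitz (f (x i) - c) (f (x k) - c).
      rewrite opprB addrA subrK -/(s _) -/(s _) => h.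
      have b1 : beta <= eta / 3 by rewrite ge_min lexx orbT.
      have := fxm i k => h2; move: h; rewrite ler_norml ltr_norml => /andP[? ?].
      by apply/andP; split; lra.
    have [x' [Dx' hx' sx' lx']] := lP _ (Dx k) sk.
    exists x'; split => //; apply: fr2 => //.
    have := hue_close N0 hx' (s_gt0 _ Dx') (s_gt0 _ (Dx k)) sx' sk.
    by rewrite opprB addrA subrK => h; exact: le_lt_trans h HN.
  (* Three different labels would put all [y k] within [9 * tau < d] of [z0], in particular the
     vertex [x i], which would then be in the second region. *)
  apply/negP; rewrite [X in uniq X]/=; have [_ -> _] := yP (inord 0); have [_ -> _] := yP (inord 1).
  have [_ -> _] := yP (inord 2) => U.
  have yy j k : normc ((y j - z0) - (y k - z0)) < 3 * tau.
    rewrite opprB addrA subrK; have [yj _ _] := yP j; have [yk _ _] := yP k.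
    have := normc_distD (y j) (x j) (y k); have := normc_distD (x j) (x k) (y k).
    rewrite (normc_distC (x k)); have := xm j k.
    have : m <= tau by rewrite ge_min lexx orbT.
    by lra.
  have y3 k : normc (y k - z0) <= 3 * (3 * tau).
    have U1 := U; rewrite -uniq3_rot in U1; have U2 := U1; rewrite -uniq3_rot in U2.
    have : k = inord 0 \/ k = inord 1 \/ k = inord 2.
      case: k => -[|[|[|//]]] k3; [left|right;left|right;right];
        by apply/val_inj; rewrite /= inordK.
    by move=> [->|[->|->]]; [apply: quadrant_near U|apply: quadrant_near U1|apply: quadrant_near U2].
  have [_ _ /(_ xi) yx] := yP i.
  have : s (x i) < s0.
    by apply: s_near => //; rewrite -yx; apply: le_lt_trans (y3 i) _; rewrite /tau; lra.
  by rewrite ltNge xi.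
(* The grid step [2 * e / n] is below [m / 2], so that a diagonal, bounded by two steps, is shorter
   than [m]. *)
pose n := (Num.trunc (4 * e / m)).+1.
have n0 : 0 < n%:R :> R by rewrite ltr0n.
have nm : 2 * e / n%:R < m / 2.
  by have := truncnS_gt (4 * e / m); rewrite -/n ltr_pdivrMr// ltr_pdivrMr//; lra.
pose g (i : nat) : R := e * (2 * (i%:R / n%:R) - 1).
have g0 : g 0%N = - e by rewrite /g mul0r; lra.
have gn : g n = e by rewrite /g divff ?gt_eqF//; lra.
have gle i : (i <= n)%N -> `|g i| <= e.
  move=> i_n; have : 0 <= i%:R / n%:R :> R by rewrite divr_ge0// ltW.
  have : i%:R / n%:R <= 1 :> R by rewrite ler_pdivrMr// mul1r ler_nat.
  rewrite /g; set q := i%:R / n%:R => q1 q0; rewrite normrM (gtr0_norm e0).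
  apply: ler_piMr; first exact: ltW.
  by rewrite ler_norml; apply/andP; split; lra.
have gS i : g i.+1 - g i = 2 * e / n%:R.
  by rewrite /g -natr1; field; rewrite gt_eqF.
have en0 : 0 < 2 * e / n%:R by rewrite divr_gt0// mulr_gt0.
pose pt i j : Cplx R := z0 + (g i +i* g j).
have ptE i j : pt i j - z0 = g i +i* g j by rewrite /pt addrC addKr.
have Dpt i j : (i <= n)%N -> (j <= n)%N -> D (pt i j).
  by move=> i_n jn; rewrite /D /square /= ptE /=; split; exact: gle.
have step i j : normc (pt i j - pt i.+1 j) < m /\ normc (pt i j - pt i j.+1) < m /\
    normc (pt i j - pt i.+1 j.+1) < m.
  have E a b a' b' : normc (pt a b - pt a' b') <= `|g a' - g a| + `|g b' - g b|.
    rewrite (_ : pt a b - pt a' b' = (pt a b - z0) - (pt a' b' - z0)).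
      rewrite !ptE; apply: le_trans (normc_le_ReIm _) _.
      by rewrite ReB ImB /= distrC [X in _ + X]distrC.
    by rewrite opprB addrA subrK.
  do ![split]; apply: le_lt_trans (E _ _ _ _) _; rewrite ?subrr ?gS ?normr0 gtr0_norm//; lra.
have ptri a b c' : D a -> D b -> D c' -> normc (a - b) < m -> normc (b - c') < m ->
    normc (a - c') < m -> ~~ uniq [:: lab a; lab b; lab c'].
  move=> Da Db Dc ab bc ac.
  have := tri (fun i => nth a [:: a; b; c'] i); rewrite /= !inordK//=; apply.
    by case => -[|[|[|//]]].
  by case => -[|[|[|//]]] ? [] [|[|[|//]]] ? /=; rewrite ?subrr ?normc0// normc_distC.
have lab_far x : D x -> e <= normc (x - z0) -> lab x = quadrant (x - z0).
  by move=> Dx /(s_far _ Dx) h; rewrite /lab h.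
have Refar i j : `|g i| = e -> e <= normc (pt i j - z0).
  by move=> <-; rewrite ptE; exact: (Re_normc (g i +i* g j : Cplx R)).
have Imfar i j : `|g j| = e -> e <= normc (pt i j - z0).
  by move=> <-; rewrite ptE; exact: (Im_normc (g i +i* g j : Cplx R)).
have g0e : `|g 0%N| = e by rewrite g0 normrN gtr0_norm.
have gne : `|g n| = e by rewrite gn gtr0_norm.
apply: (@sperner_square n (fun i j => lab (pt i j))).
- move=> i j i_n jn; have [s1 [s2 s3]] := step i j.
  have [_ [s4 _]] := step i.+1 j; have [s5 _] := step i j.+1.
  by split; apply: ptri => //; apply: Dpt => //; exact: ltnW.
- move=> i i_n; rewrite lab_far; [|exact: Dpt|exact: Imfar].
  by rewrite ptE /quadrant /= g0 oppr_lt0 e0.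
- move=> i i_n; rewrite lab_far; [|exact: Dpt|exact: Imfar].
  by rewrite ptE /quadrant /= gn ltNge ltW.
- move=> j jn; rewrite lab_far; [|exact: Dpt|exact: Refar].
  by rewrite ptE /quadrant /= g0 oppr_ge0 leNgt e0; case: ifP.
- move=> j jn; rewrite lab_far; [|exact: Dpt|exact: Refar].
  by rewrite ptE /quadrant /= gn (ltW e0); case: ifP.
Qed.

End InvarianceOfDomain.

(** * Urysohn functions along a chain *)

Lemma exp2_small (R : realType) (e : R) : 0 < e -> exists n : nat, 3 / 2 ^+ n < e.
Proof.
move=> e0; exists (Num.trunc (3 / e)).+1; set n := (Num.trunc _).+1.
rewrite ltr_pdivrMr ?exprn_gt0// mulrC -ltr_pdivrMr//.
apply: lt_trans (truncnS_gt _) _; rewrite -/n -natrX ltr_nat; exact: ltn_expl.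
Qed.

(** [f x] is the supremum of the dyadic numbers [k / 2^n] with [x] outside [G (c n k)], for chains
    [c n] from [p] to [q] refined by density. A set [A] as in the last clause that meets one [G] of
    the chain is contained in the next [H], so [f] varies on it by at most three dyadic steps. *)
Lemma urysohn_chain (R : realType) (U : topologicalType) (Q : set U) (I : Type)
    (G H : I -> set U) (lt : I -> I -> Prop) (p q : I) :
  (forall i x, G i x -> \forall y \near x, Q y -> G i y) ->
  (forall i, closed (H i)) ->
  (forall i, G i `<=` H i) ->
  (forall i j, lt i j -> H i `<=` G j) ->
  (forall i j, lt i j -> exists k, lt i k /\ lt k j) ->
  lt p q ->
  exists f : U -> R, [/\ {within Q, continuous f}, forall x, H p x -> f x = 0,
    forall x, ~ G q x -> f x = 1 &
    forall A : set U, (forall i j, lt i j -> A `&` G i !=set0 -> A `<=` H j) ->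
      forall x y, A x -> A y -> f x = f y].
Proof.
move=> Gop Hcl GH HG dense ltpq.
have [m mP] : exists m : I * I -> I, forall i j, lt i j -> lt i (m (i, j)) /\ lt (m (i, j)) j.
  have /choice[m mP] : forall ij, exists k, lt ij.1 ij.2 -> lt ij.1 k /\ lt k ij.2.
    move=> [i j] /=; have [/dense[k ?]|?] := pselect (lt i j); last by exists i.
    by exists k.
  by exists m => i j; exact: mP (i, j).
(* [c n 0, ..., c n (2 ^ n)] is the chain of depth [n]: even indices repeat the previous depth, odd
   ones insert midpoints. *)
pose fix c (n k : nat) {struct n} : I := match n with
  | 0%N => if k is 0%N then p else q
  | n'.+1 => if odd k then m (c n' k./2, c n' k./2.+1) else c n' k./2 end.
have c2 n k : c n.+1 k.*2 = c n k by rewrite /= odd_double doubleK.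
have cexp n d k : c (n + d)%N (k * 2 ^ d)%N = c n k.
  by elim: d => [|d IH]; rewrite ?addn0 ?muln1// addnS expnSr mulnA muln2 c2.
have clt n k : (k < 2 ^ n)%N -> lt (c n k) (c n k.+1).
  elim: n k => [|n IH] k; first by rewrite expn0 ltnS leqn0 => /eqP ->.
  rewrite expnSr muln2 => kn; have k2 : (k./2 < 2 ^ n)%N by rewrite ltn_half_double.
  have [lo hi] := mP _ _ (IH _ k2).
  rewrite /=; have [ok|ek] := boolP (odd k); last by rewrite uphalf_half (negbTE ek).
  by rewrite uphalf_half ok.
have c0 n : c n 0%N = p by elim: n.
have c01 : c 0%N 1%N = q by [].
have GG n k l : (k <= l)%N -> (l <= 2 ^ n)%N -> G (c n k) `<=` G (c n l).
  elim: l => [|l IH]; first by rewrite leqn0 => /eqP -> _ x.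
  rewrite leq_eqVlt => /predU1P[-> _ x //|]; rewrite ltnS => kl ln.
  apply: subset_trans (IH kl (ltnW ln)) _; apply: subset_trans (@GH _) _.
  exact: HG (clt _ _ ln).
pose S x : set R := [set r | r = 0 \/ exists n k : nat,
  [/\ (k <= 2 ^ n)%N, ~ G (c n k) x & r = k%:R / 2 ^+ n]].
pose f x := sup (S x).
have e2 n : 0 < 2 ^+ n :> R by rewrite exprn_gt0.
have S1 x : ubound (S x) 1.
  move=> r [->//|[n [k [kn _ ->]]]].
  by rewrite ler_pdivrMr// mul1r -natrX ler_nat.
have S0 x : S x !=set0 by exists 0; left.
have fub x r : S x r -> r <= f x.
  by move=> Sr; apply: sup_upper_bound => //; split => //; exists 1; exact: S1.
have f0 x : 0 <= f x by apply: fub; left.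
have f1 x : f x <= 1 by apply: ge_sup => //; exact: S1.
have fG n k x : (k <= 2 ^ n)%N -> G (c n k) x -> f x <= k%:R / 2 ^+ n.
  move=> kn Gx; apply: ge_sup => // r [->|[n' [k' [kn' NGx ->]]]].
    by rewrite divr_ge0// ltW.
  rewrite ler_pdivrMr// mulrAC ler_pdivlMr// -!natrX -!natrM ler_nat leqNgt.
  apply/negP => kk; apply: NGx; rewrite -(cexp n' n).
  apply: (@GG _ (k * 2 ^ n')%N); first exact: ltnW.
    by rewrite expnD leq_mul2r kn' orbT.
  by rewrite addnC cexp.
have fNG n k x : (k <= 2 ^ n)%N -> ~ G (c n k) x -> k%:R / 2 ^+ n <= f x.
  by move=> kn NG; apply: fub; right; exists n, k.
(* [K] is the first index with [x] in [G (c n K)], or [2 ^ n + 1] if there is none. *)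
have level n x : exists K : nat, [/\ (K <= (2 ^ n).+1)%N, ((K <= 2 ^ n)%N -> G (c n K) x),
    (forall k, (k < K)%N -> (k <= 2 ^ n)%N -> ~ G (c n k) x),
    f x <= K%:R / 2 ^+ n & (K%:R - 1) / 2 ^+ n <= f x].
  have bnd K : ((K <= 2 ^ n)%N -> G (c n K) x) ->
      (forall k, (k < K)%N -> (k <= 2 ^ n)%N -> ~ G (c n k) x) ->
      (K <= (2 ^ n).+1)%N ->
      f x <= K%:R / 2 ^+ n /\ (K%:R - 1) / 2 ^+ n <= f x.
    move=> KG KN Kn; split.
      have [kn|kn] := leqP K (2 ^ n); first exact: fG (KG kn).
      by apply: le_trans (f1 x) _; rewrite ler_pdivlMr// mul1r -natrX ler_nat ltnW.
    case: K KG KN Kn => [|K] KG KN Kn.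
      by rewrite sub0r mulN1r; apply: le_trans (f0 x); rewrite oppr_le0 invr_ge0 ltW.
    by rewrite -natr1 addrK; apply: fNG => //; exact: KN.
  have [[k0 [k0n Gk0]]|nG] := pselect (exists k, (k <= 2 ^ n)%N /\ G (c n k) x).
    have ex : exists k, (k <= 2 ^ n)%N && `[< G (c n k) x >].
      by exists k0; rewrite k0n; apply/asboolP.
    case: (ex_minnP ex) => K /andP[Kn /asboolP GK] Kmin.
    have KN k : (k < K)%N -> (k <= 2 ^ n)%N -> ~ G (c n k) x.
      move=> kK kn Gk; have := Kmin k; rewrite kn /= leqNgt kK.
      by move=> /(_ (introT (asboolP _) Gk)).
    have [] := bnd K (fun _ => GK) KN; first exact: leqW.
    by exists K; split => //; exact: leqW.
  have KG : ((2 ^ n).+1 <= 2 ^ n)%N -> G (c n (2 ^ n).+1) x by rewrite ltnn.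
  have KN k : (k < (2 ^ n).+1)%N -> (k <= 2 ^ n)%N -> ~ G (c n k) x.
    by move=> _ kn Gk; apply: nG; exists k.
  by have [] := bnd _ KG KN (leqnn _); exists (2 ^ n).+1.
exists f; split.
- apply/subspace_continuousP => x Qx A /nbhs_ballP[e /= e0 eA].
  have [n ne] := exp2_small e0; have [K [Kn KG KN fK Kf]] := level n x.
  have nG : \forall y \near x, Q y -> (K <= 2 ^ n)%N -> G (c n K) y.
    have [kn|_] := leqP K (2 ^ n); last by apply: nearW.
    by apply: filterS (Gop _ _ (KG kn)) => y h Qy _; exact: h.
  (* [H (c n (K - 2))] is closed and contained in [G (c n (K - 1))], which misses [x]; for [K < 2]
     the claim is void. *)
  have nH : \forall y \near x, forall k, (k.+2 = K)%N -> (k < 2 ^ n)%N -> ~ H (c n k) y.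
    case: K {fK Kf nG KG Kn} KN => [|[|K]] KN; [by apply: nearW|by apply: nearW|].
    have [kn|kn] := ltnP K (2 ^ n); last first.
      by apply: nearW => y k [->]; rewrite ltnNge kn.
    have nHx : nbhs x (~` H (c n K)).
      apply: open_nbhs_nbhs; split; first exact: closed_openC.
      by move=> /(HG _ _ (clt _ _ kn)); exact: KN.
    by apply: filterS nHx => y Hy k [->].
  apply: filterS2 nG nH => y nG nH Qy; apply: eA; rewrite /ball /=.
  have yK : f y <= K%:R / 2 ^+ n.
    have [kn|kn] := leqP K (2 ^ n); first exact: fG (nG Qy kn).
    by apply: le_trans (f1 y) _; rewrite ler_pdivlMr// mul1r -natrX ler_nat ltnW.
  have Ky : (K%:R - 2) / 2 ^+ n <= f y.
    case: K Kn nH {KG KN fK Kf nG yK} => [|[|K]] Kn nH.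
    - by apply: le_trans (f0 y); rewrite mulr_le0_ge0 ?invr_ge0 ?(ltW (e2 _))//; lra.
    - by apply: le_trans (f0 y); rewrite mulr_le0_ge0 ?invr_ge0 ?(ltW (e2 _))//; lra.
    - have -> : K.+2%:R - 2 = K%:R :> R by rewrite -addn2 natrD addrK.
      apply: fNG; first exact: ltnW.
      by move=> /(@GH _ _); exact: nH.
  move: fK Kf yK Ky ne; set w := (2 ^+ n)^-1; have w0 : 0 < w by rewrite invr_gt0.
  have E1 : (K%:R - 1) * w = K%:R * w - w by ring.
  have E2 : (K%:R - 2) * w = K%:R * w - 2 * w by ring.
  rewrite E1 E2 => h1 h2 h3 h4 h5; change (`|f x - f y| < e).
  by rewrite ltr_norml; apply/andP; split; lra.
- move=> x Hx; apply/le_anti; rewrite f0 andbT.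
  apply/ler_addgt0Pr => e e0; have [n ne] := exp2_small e0; rewrite add0r.
  apply: le_trans (ltW ne).
  have : f x <= 1 / 2 ^+ n.+1.
    apply: (@fG n.+1 1%N x); first by rewrite expn_gt0.
    by apply: (HG _ _ (clt n.+1 0%N _)); rewrite ?c0// expn_gt0.
  move=> h; apply: le_trans h _; rewrite exprS invfM.
  have w0 : 0 < (2 ^+ n)^-1 :> R by rewrite invr_gt0.
  by lra.
- move=> x NG; apply/le_anti; rewrite f1 /=.
  by have := @fNG 0%N 1%N x isT NG; rewrite expr0 divr1.
- move=> A AP; suff lefA x y : A x -> A y -> f y <= f x.
    by move=> x y Ax Ay; apply/le_anti; rewrite !lefA.
  move=> Ax Ay; apply/ler_addgt0Pr => e e0; have [n ne] := exp2_small e0.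
  have [K [Kn KG KN fK Kf]] := level n x.
  suff yK : f y <= K.+2%:R / 2 ^+ n.
    have E : K.+2%:R = K%:R + 2 :> R by rewrite -addn2 natrD.
    move: Kf yK ne; rewrite E; set w := (2 ^+ n)^-1 => h1 h2 h3.
    have h4 : (K%:R + 2) * w = (K%:R - 1) * w + 3 * w by ring.
    lra.
  have [kn|kn] := leqP K.+2 (2 ^ n); last first.
    by apply: le_trans (f1 y) _; rewrite ler_pdivlMr// mul1r -natrX ler_nat ltnW.
  apply: fG => //; apply: (HG _ _ (clt n K.+1 _)) => //.
  apply: (AP _ _ (clt n K _)) => //; first exact: ltnW.
  by exists x; split => //; apply: KG; apply: ltnW; exact: ltnW.
Qed.

(** * Components of compact plane sets *)

(** Otherwise the sets [K & B i] minus [O] generate a proper filter; a cluster point in [K] lies in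
    every [B i], hence in the open set [O], which the filter avoids. *)
Lemma compact_directed_sub (U : topologicalType) (K O : set U) (I : Type) (i0 : I)
    (B : I -> set U) :
  compact K -> open O -> (forall i, closed (B i)) ->
  (forall i j, exists k, B k `<=` B i `&` B j) ->
  (forall x, K x -> (forall i, B i x) -> O x) -> exists i, K `&` B i `<=` O.
Proof.
move=> cK oO cB dB KO; apply: contrapT => /forallNP nB.
pose F := filter_from [set: I] (fun i => (K `&` B i) `\` O).
have FF : ProperFilter F.
  apply: filter_from_proper.
    apply: filter_from_filter; first by exists i0.
    move=> i j _ _; have [k kij] := dB i j; exists k => // x [[Kx /kij[Bi Bj]] nO].
    by split.
  by move=> i _; have /existsNP[x /not_implyP[? ?]] := nB i; exists x.
have [|p [Kp Fp]] := cK F FF; first by exists i0 => // x [[]].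
have Op : O p.
  apply: KO => // i; apply: cB => C Cp.
  have [|x [[[_ Bx] _] Cx]] := Fp ((K `&` B i) `\` O) C _ Cp; first by exists i.
  by exists x.
have [|x [[_ nO] Ox]] := Fp ((K `&` B i0) `\` O) O _ (open_nbhs_nbhs (conj oO Op)).
  by exists i0.
exact: nO.
Qed.

Lemma separated_open (U : topologicalType) (A B : set U) :
  open A -> open B -> A `&` B = set0 -> separated A B.
Proof.
have h (C D : set U) : open D -> C `&` D = set0 -> closure C `&` D = set0.
  move=> oD CD; rewrite -subset0 => x [cCx Dx].
  by have := cCx D (open_nbhs_nbhs (conj oD Dx)); rewrite CD => -[].
move=> oA oB AB; split; first exact: h.
by rewrite setIC; apply: h => //; rewrite setIC.
Qed.

Section PlaneTopology.
Variable R : realType.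
Implicit Types (A B K : set (Cplx R)).

(** The two compacta are at positive distance [d], and their [d / 2]-neighbourhoods are disjoint. *)
Lemma compact_disjoint_open A B : compact A -> compact B -> A `&` B = set0 ->
  exists O1 O2, [/\ open O1, open O2, A `<=` O1, B `<=` O2 & O1 `&` O2 = set0].
Proof.
move=> cA cB AB.
have cdist (p : Cplx R * Cplx R) : {for p, continuous (fun p : Cplx R * Cplx R =>
    normc (p.1 - p.2) : R)}.
  apply: (@continuous_comp _ _ _ (fun p : Cplx R * Cplx R => p.1 - p.2)
    (@normc R : Cplx R -> R)); last exact: normc_continuous.
  by apply: cvgB; [exact: cvg_fst|exact: cvg_snd].
have [||d d0 dP] := @compact_modulus R _ (A `*` B) _ (cst 1) 0 (compact_setX cA cB)
    (fun p _ => cdist p).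
- by move=> p _; exact: cst_continuous.
- move=> [a b] [/= Aa Bb] ab; suff : (A `&` B) a by rewrite AB.
  split => //; rewrite (_ : a = b)//; apply/eqP; rewrite -subr_eq0.
  by apply/eqP/eq0_normc/le_anti; rewrite ab normc_ge0.
have Bd a b : A a -> B b -> d <= normc (a - b).
  move=> Aa Bb; rewrite leNgt; apply/negP => ab.
  by have := dP (a, b) (conj Aa Bb) ab; rewrite /= ltr10.
have oT (C : set (Cplx R)) : open [set z | exists2 c, C c & normc (z - c) < d / 2].
  rewrite openE => z [c Cc zc]; apply/nbhs_normcP.
  exists (d / 2 - normc (z - c)); first by rewrite subr_gt0.
  by move=> w wz; exists c => //; have := normc_distD w z c; lra.
exists [set z | exists2 c, A c & normc (z - c) < d / 2].
exists [set z | exists2 c, B c & normc (z - c) < d / 2]; split => //.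
- by move=> a Aa; exists a => //; rewrite subrr normc0 divr_gt0.
- by move=> a Aa; exists a => //; rewrite subrr normc0 divr_gt0.
- rewrite -subset0 => z [[a Aa za] [b Bb zb]]; have := Bd _ _ Aa Bb.
  by have := normc_distD a z b; rewrite (normc_distC a z); lra.
Qed.

(** In a compact set components are quasi-components. Were the quasi-component [q] of [x] a union of
    separated parts [P] and [P'], disjoint open neighbourhoods of these would cover a clopen part of
    [K] around [q], which could be cut further to exclude [P']. *)
Lemma component_clopen K x y : compact K -> K x -> K y ->
  ~ connected_component K x y -> exists A B,
    [/\ closed A, closed B, A `|` B = K, A `&` B = set0 & A x /\ B y].
Proof.
move=> cK Kx Ky Cxy; apply: contrapT => noAB; apply: Cxy.
pose split AB := [/\ closed AB.1, closed AB.2, AB.1 `|` AB.2 = K, AB.1 `&` AB.2 = set0 &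
  AB.1 x].
have clK : closed K by apply: compact_closed cK; exact: Cplx_hausdorff.
pose q := [set z | K z /\ forall AB, split AB -> AB.1 z].
have qx : q x by split => // AB [].
have qy : q y.
  split => // -[A B] /= [cA cB ABK AB0 Ax].
  by move: Ky; rewrite -ABK => -[//|By]; exfalso; apply: noAB; exists A, B.
have qK : q `<=` K by move=> z [].
have clq : closed q.
  move=> z clz; split; first by apply: clK; apply: closureS clz.
  move=> AB sAB; have [cA _ _ _ _] := sAB; apply: cA; apply: closureS clz.
  by move=> u [_]; exact.
suff cq : connected q by exists q.
apply/connectedP => E [E0 qE sE].
suff no P P' : P !=set0 -> P' !=set0 -> q = P `|` P' -> separated P P' -> ~ P x.
  move: (qx); rewrite qE => -[|]; first exact: (no _ _ (E0 false) (E0 true)).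
  by apply: (no _ _ (E0 true) (E0 false)); rewrite ?qE 1?setUC// separatedC.
move=> P0 [p' P'p'] qP [PP' PP'2] Px.
have clP : closed P.
  move=> z clz; have : q z by apply: clq; apply: closureS clz; rewrite qP => ? ?; left.
  by rewrite qP => -[//|P'z]; suff : (closure P `&` P') z by rewrite PP'.
have clP' : closed P'.
  move=> z clz; have : q z by apply: clq; apply: closureS clz; rewrite qP => ? ?; right.
  by rewrite qP => -[Pz|//]; suff : (P `&` closure P') z by rewrite PP'2.
have PK : P `<=` K by apply: subset_trans qK; rewrite qP => ? ?; left.
have P'K : P' `<=` K by apply: subset_trans qK; rewrite qP => ? ?; right.
have [|||W [W' [oO oO' PO PO' OO']]] := @compact_disjoint_open P P'.
- exact: subclosed_compact cK PK.
- exact: subclosed_compact cK P'K.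
- by rewrite -subset0 => z [/subset_closure ? ?]; rewrite -PP'.
have splitK : split (K, set0).
  by split => //=; rewrite ?setU0 ?setI0//; exact: closed0.
have [ | | | | [[A B] [/= cA cB ABK AB0 Ax]] /= AO] :=
  @compact_directed_sub _ K (W `|` W') {AB : set (Cplx R) * set (Cplx R) | split AB} (exist _ _ splitK)
    (fun AB => (sval AB).1) cK.
- exact: openU.
- by move=> [AB []].
- move=> [[A B] /= sAB] [[A' B'] /= sAB'].
  have sAA : split (A `&` A', (K `&` B) `|` (K `&` B')).
    move: sAB sAB' => [/= cA cB ABK AB0 Ax] [/= cA' cB' ABK' AB0' Ax'].
    split => //=; first exact: closedI.
    - by apply: closedU; exact: closedI.
    - apply/seteqP; split => [z [[Az _]|[[]|[]]]//|z Kz]; first by rewrite -ABK; left.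
      have [Az|nA] := pselect (A z); have [A'z|nA'] := pselect (A' z).
      + by left.
      + by right; right; split => //; move: Kz; rewrite -{1}ABK' => -[].
      + by right; left; split => //; move: Kz; rewrite -{1}ABK => -[].
      + by right; left; split => //; move: Kz; rewrite -{1}ABK => -[].
    - rewrite -subset0 => z [[Az A'z] [[_ Bz]|[_ Bz]]]; first by rewrite -AB0.
      by rewrite -AB0'.
  by exists (exist _ _ sAA).
- move=> z Kz zAB; have : q z by split => // AB sAB; exact: (zAB (exist _ _ sAB)).
  by rewrite qP => -[/PO|/PO']; [left|right].
(* As [A] is covered by the disjoint open sets [W] and [W'], removing [W'] leaves a clopen part of
   [K]. *)
have sA : split (A `\` W', B `|` (A `\` W)).
  have AK : A `<=` K by move=> z Az; rewrite -ABK; left.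
  split => /=.
  - by rewrite setDE; apply: closedI => //; exact: open_closedC.
  - by apply: closedU => //; rewrite setDE; apply: closedI => //; exact: open_closedC.
  - apply/seteqP; split => [z|z Kz].
      by rewrite -[in K z]ABK => -[[Az _]|[Bz|[Az _]]]; [left|right|left].
    move: (Kz); rewrite -{1}ABK => -[Az|Bz]; last by right; left.
    have [Oz|Oz] := pselect (W z); last by right; right.
    by left; split => // W'z; suff : (W `&` W') z by rewrite OO'.
  - rewrite -subset0 => z [[Az nW'] [Bz|[_ nW]]]; first by rewrite -AB0.
    by case: (AO z (conj (AK _ Az) Az)).
  - split => // W'x; suff : (W `&` W') x by rewrite OO'.
    by split => //; exact: PO.
have [_ /(_ _ sA) /= [_ +]] : q p' by rewrite qP; right.
by apply; exact: PO'.
Qed.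

End PlaneTopology.

(** * The quotient by components of fibres *)

Section FinalTopology.
Variables (S : topologicalType) (V : Type) (Q : set S) (e : S -> V).

(** The quotient of [Q] by the fibres of [e]; only values attained on [Q] are kept, so that [Q] maps
    onto it. *)
Definition final_image : Type := {v : V | exists2 x, Q x & e x = v}.

Definition to_final x (Qx : Q x) : final_image := exist _ (e x) (ex_intro2 _ _ x Qx erefl).

HB.instance Definition _ := gen_eqMixin final_image.
HB.instance Definition _ := gen_choiceMixin final_image.

Definition final_open (W : set final_image) := forall x (Qx : Q x), W (to_final Qx) ->
  \forall y \near x, forall Qy : Q y, W (to_final Qy).

Lemma final_openT : final_open setT.
Proof. by move=> x Qx _; exact: nearW. Qed.

Lemma final_openI (A B : set final_image) :
  final_open A -> final_open B -> final_open (A `&` B).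
Proof.
move=> oA oB x Qx [Ax Bx]; apply: filterS2 (oA x Qx Ax) (oB x Qx Bx) => y hA hB Qy.
by split.
Qed.

Lemma final_open_bigU (I : Type) (f : I -> set final_image) :
  (forall i, final_open (f i)) -> final_open (\bigcup_i f i).
Proof.
move=> fo x Qx [i _ fix_]; apply: filterS (fo i x Qx fix_) => y h Qy.
by exists i => //; exact: h.
Qed.

HB.instance Definition _ := @isOpenTopological.Build final_image final_open
  final_openT final_openI final_open_bigU.

Lemma final_openE (W : set final_image) : open W = final_open W.
Proof. by []. Qed.

Variables (x0 : S) (Qx0 : Q x0).

(** Maps on [Q] are total functions, so points outside [Q] are sent to the class of [x0]. *)
Definition final_map x : final_image :=
  if pselect (Q x) is left Qx then to_final Qx else to_final Qx0.

Lemma final_mapE x (Qx : Q x) : final_map x = to_final Qx.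
Proof.
rewrite /final_map; case: pselect => // Qx'; congr to_final; exact: Prop_irrelevance.
Qed.

Lemma final_map_eq x y : Q x -> Q y -> final_map x = final_map y <-> e x = e y.
Proof.
move=> Qx Qy; rewrite !final_mapE; split => [[]//|exy].
by apply: eq_exist; exact: exy.
Qed.

Lemma final_map_surj : final_map @` Q = setT.
Proof.
apply/seteqP; split => // -[v [x Qx exv]] _; exists x => //.
rewrite final_mapE; subst v; congr exist; exact: Prop_irrelevance.
Qed.

Lemma final_openP (W : set final_image) : open W <->
  forall x, Q x -> W (final_map x) -> \forall y \near x, Q y -> W (final_map y).
Proof.
rewrite final_openE; split => Wo x Qx.
  rewrite final_mapE => Wx; apply: filterS (Wo x Qx Wx) => y h Qy.
  by rewrite final_mapE; exact: h.
move=> Wx; have := Wo x Qx; rewrite final_mapE => /(_ Wx).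
by apply: filterS => y h Qy; have := h Qy; rewrite final_mapE.
Qed.

Lemma final_map_continuous : {within Q, continuous final_map}.
Proof.
apply/subspace_continuousP => x Qx A; rewrite nbhsE => -[W [/final_openP Wo Wx] WA].
by apply: filterS (Wo x Qx Wx) => y h Qy; apply: WA; exact: h.
Qed.

End FinalTopology.

(** * Components of the fibres of a continuous function *)

Section MonotoneQuotient.
Variables (R : realType) (Q : set (Cplx R)) (f : Cplx R -> R).
Hypotheses (cQ : compact Q) (cf : {within Q, continuous f}).

Definition fibre_component x := connected_component (Q `&` f @^-1` [set f x]) x.

Lemma fibre_component_refl x : Q x -> fibre_component x x.
Proof. by move=> Qx; apply: connected_component_refl. Qed.

Lemma fibre_component_sub x : fibre_component x `<=` Q `&` f @^-1` [set f x].
Proof. exact: connected_component_sub. Qed.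

Lemma fibre_component_eq x y : fibre_component x y -> fibre_component x = fibre_component y.
Proof.
move=> xy; have [Qy /= fy] := fibre_component_sub xy.
by rewrite /fibre_component fy; exact: same_connected_component.
Qed.

Lemma fibre_component_eqf x y : Q y -> fibre_component x = fibre_component y -> f x = f y.
Proof.
move=> Qy xy; have := fibre_component_refl Qy; rewrite -xy.
by move=> /fibre_component_sub[_ /= ->].
Qed.

Lemma near_within x (W : set R) : Q x -> nbhs (f x) W -> \forall y \near x, Q y -> W (f y).
Proof. by move=> Qx; move/subspace_continuousP : cf => /(_ x Qx); exact. Qed.

Lemma fibre_closed (t : R) : closed (Q `&` f @^-1` [set t]).
Proof.
have clQ : closed Q by apply: compact_closed cQ; exact: Cplx_hausdorff.
move=> x clx; have Qx : Q x by apply: clQ; apply: closureS clx => y [].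
split => //=; apply: contrapT => /eqP fxt.
have /near_within := Qx; move=> /(_ [set s | s != t]) h.
have {h}/clx[y [[Qy /= fy] /(_ Qy)]] : \forall y \near x, Q y -> f y != t.
  by apply: h; apply: open_nbhs_nbhs; split => //; exact: open_neq.
by rewrite fy eqxx.
Qed.

(** Gives the Hausdorff property of the quotient. If [f x = f y], the fibre splits into clopen parts
    with disjoint open neighbourhoods [W1] and [W2]. By compactness the fibres over values close to
    [f x] stay in their union, and each component of such a fibre lies in one of them. *)
Lemma fibre_component_separation x y : Q x -> Q y ->
  fibre_component x <> fibre_component y -> exists D1 D2 : set (Cplx R),
  [/\ D1 x, D2 y, forall z, Q z -> ~ (D1 z /\ D2 z) &
    forall D, D = D1 \/ D = D2 ->
      (forall z, Q z -> D z -> \forall z' \near z, Q z' -> D z') /\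
      (forall z z', Q z -> D z -> fibre_component z z' -> D z')].
Proof.
move=> Qx Qy xy; have [fxy|fxy] := eqVneq (f x) (f y); last first.
  pose d := `|f x - f y| / 2; have d0 : 0 < d by rewrite divr_gt0// normr_gt0 subr_eq0.
  exists [set z | `|f z - f x| < d], [set z | `|f z - f y| < d]; split => /=.
  - by rewrite subrr normr0.
  - by rewrite subrr normr0.
  - move=> z _ [zx zy]; have := ler_distD (f z) (f x) (f y).
    by rewrite (distrC (f x) (f z)); move: zx zy; rewrite /d; lra.
  - have H t : (forall z, Q z -> `|f z - t| < d -> \forall z' \near z, Q z' -> `|f z' - t| < d) /\
        (forall z z', Q z -> `|f z - t| < d -> fibre_component z z' -> `|f z' - t| < d).
      split; last by move=> z z' Qz zt /fibre_component_sub[_ /= ->].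
      move=> z Qz zt; apply: (near_within Qz (W := [set s | `|s - t| < d])).
      apply: open_nbhs_nbhs; split => //.
      rewrite (_ : [set s | _] = ball t d); first exact: ball_open.
      by apply/seteqP; split => s; rewrite /ball /= distrC.
    by move=> D [->|->]; exact: H.
set K := Q `&` f @^-1` [set f x].
have cK : compact K by apply: (subclosed_compact _ cQ); [exact: fibre_closed|move=> z []].
have Ky : K y by split => //=; rewrite fxy.
have nxy : ~ connected_component K x y by move=> /fibre_component_eq.
have Kx : K x by [].
have [A [B [clA clB ABK AB0 [Ax By]]]] := component_clopen cK Kx Ky nxy.
have AK : A `<=` K by rewrite -ABK => z; left.
have BK : B `<=` K by rewrite -ABK => z; right.
have [W1 [W2 [oW1 oW2 AW1 BW2 W12]]] :=
  compact_disjoint_open (subclosed_compact clA cK AK) (subclosed_compact clB cK BK) AB0.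
have [d d0 dP] : exists2 d, 0 < d & forall z, Q z -> `|f z - f x| < d -> (W1 `|` W2) z.
  move/compact_near_coveringP : (cQ) => ncQ.
  have [|e /= e0 h] := ncQ R (0^'+)%classic
    (fun d z => Q z -> `|f z - f x| < d -> (W1 `|` W2) z).
    move=> z Qz; have [fz|fz] := eqVneq (f z) (f x).
      exists (W1 `|` W2, setT); last by move=> [z' d] [/= ? _] _ _.
      split; last exact: filterT.
      apply: open_nbhs_nbhs; split; first exact: openU.
      have : K z by [].
      by rewrite -ABK => -[/AW1|/BW2]; [left|right].
    have e0 : 0 < `|f z - f x| / 2 by rewrite divr_gt0// normr_gt0 subr_eq0.
    exists ([set z' | Q z' -> `|f z - f x| / 2 < `|f z' - f x|],
      [set d | d < `|f z - f x| / 2]); last first.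
      by move=> [z' d] /= [h1 h2] Qz' h3; have := h1 Qz'; lra.
    split; last exact: nbhs_right_lt.
    apply: (near_within Qz (W := [set s | `|f z - f x| / 2 < `|s - f x|])).
    apply/nbhs_ballP; exists (`|f z - f x| / 2) => //= s; rewrite /ball /= => zs.
    by have := ler_distD s (f z) (f x); lra.
  exists (e / 2); first by rewrite divr_gt0.
  move=> z Qz; apply: (h (e / 2)) => //=; last by rewrite divr_gt0.
  by rewrite sub0r normrN gtr0_norm ?divr_gt0// ltr_pdivrMr//; lra.
have nearD D z : open D -> Q z -> `|f z - f x| < d /\ D z ->
    \forall z' \near z, Q z' -> `|f z' - f x| < d /\ D z'.
  move=> oD Qz [zd Dz].
  have nfz : nbhs (f z) [set s | `|s - f x| < d].
    apply: open_nbhs_nbhs; split => //.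
    rewrite (_ : [set s | _] = ball (f x) d); first exact: ball_open.
    by apply/seteqP; split => s; rewrite /ball /= distrC.
  apply: filterS2 (near_within Qz nfz) (open_nbhs_nbhs (conj oD Dz)) => z' h Dz' Qz'.
  by split => //; exact: h.
have compW z : `|f z - f x| < d -> fibre_component z `<=` W1 \/ fibre_component z `<=` W2.
  move=> zd; apply: (connected_subset (separated_open oW1 oW2 W12)).
    by move=> z' /fibre_component_sub[Qz' /= fz']; apply: dP => //; rewrite fz'.
  exact: component_connected.
exists [set z | `|f z - f x| < d /\ W1 z], [set z | `|f z - f x| < d /\ W2 z]; split => /=.
- by rewrite subrr normr0; split => //; exact: AW1.
- by rewrite fxy subrr normr0; split => //; exact: BW2.
- by move=> z _ [[_ zW1] [_ zW2]]; suff : (W1 `&` W2) z by rewrite W12.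
- move=> D [->|->]; split.
  + by move=> z Qz; exact: nearD.
  + move=> z z' Qz /= [zd zW1] zz'; have [_ /= ->] := fibre_component_sub zz'; split => //.
    case: (compW z zd) => h; first exact: h.
    suff : (W1 `&` W2) z by rewrite W12.
    by split => //; apply: h; exact: fibre_component_refl.
  + by move=> z Qz; exact: nearD.
  + move=> z z' Qz /= [zd zW2] zz'; have [_ /= ->] := fibre_component_sub zz'; split => //.
    case: (compW z zd) => h; last exact: h.
    suff : (W1 `&` W2) z by rewrite W12.
    by split => //; apply: h; exact: fibre_component_refl.
Qed.

End MonotoneQuotient.

(** * Local connectedness of the quotient *)

Section LocallyConnectedQuotient.
Variables (R : realType) (Q : set (Cplx R)) (f : Cplx R -> R).
Variables (Sg : set (Cplx R)) (imp : Cplx R -> set (Cplx R)).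
Hypotheses (cQ : compact Q) (kQ : connected Q) (Q0 : Q !=set0)
  (cf : {within Q, continuous f}) (cSg : compact Sg).
Hypotheses (imp0 : forall w, Sg w -> imp w !=set0)
  (imp_conn : forall w, Sg w -> connected (imp w))
  (impQ : forall w, Sg w -> imp w `<=` Q)
  (imp_f : forall w, Sg w -> forall x y, imp w x -> imp w y -> f x = f y)
  (imp_cover : Q `<=` \bigcup_(w in Sg) imp w)
  (imp_closed : forall w x, Sg w ->
     (forall A B, nbhs w A -> nbhs x B -> exists w',
        [/\ Sg w', A w' & imp w' `&` B !=set0]) -> imp w x)
  (Sg_lc : forall w A, Sg w -> nbhs w A -> exists A' S,
     [/\ nbhs w A', connected S, A' `&` Sg `<=` S & S `<=` A `&` Sg]).

Lemma imp_not_near w x : Sg w -> ~ imp w x -> exists A B,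
  [/\ nbhs w A, nbhs x B & forall w', Sg w' -> A w' -> imp w' `&` B = set0].
Proof.
move=> Sw nwx; apply: contrapT => h; apply: nwx; apply: imp_closed => // A B wA xB.
apply: contrapT => h'; apply: h; exists A, B; split => // w' Sw' Aw'.
by apply: contrapT => /eqP/set0P ne; apply: h'; exists w'.
Qed.

(** The graph of [imp] is closed and [Q] compact: a point of [Q] outside [imp w] has a neighbourhood
    missed by [imp w'] for [w'] close to [w]. *)
Lemma imp_usc w (P : set (Cplx R)) : Sg w ->
  (forall x, imp w x -> \forall y \near x, Q y -> P y) ->
  \forall w' \near w, Sg w' -> imp w' `<=` P.
Proof.
move=> Sw wP; move/compact_near_coveringP : (cQ) => ncQ.
have := ncQ (Cplx R) (nbhs w) (fun w' x => Q x -> Sg w' -> imp w' x -> P x).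
move=> /(_ _ _)/filterS; apply => [w' h Sw' x w'x|x Qx].
  by apply: h => //; exact: impQ w'x.
have [wx|nwx] := pselect (imp w x).
  exists ([set y | Q y -> P y], setT); first by split; [exact: wP|exact: filterT].
  by move=> [y w'] [/= h _] Qy _ _; exact: h.
have [A [B [wA xB AB]]] := imp_not_near Sw nwx.
exists (B, A) => // -[y w'] [/= By Aw'] Qy Sw' w'y.
by suff : (imp w' `&` B) y by rewrite AB.
Qed.

Local Notation e := (fibre_component Q f).

Lemma imp_fibre w x y : Sg w -> imp w x -> imp w y -> e x = e y.
Proof.
move=> Sw wx wy; apply: fibre_component_eq; exists (imp w) => //.
split => //; last exact: imp_conn.
by move=> z wz; split; [exact: impQ wz|exact: imp_f Sw _ _ wz wx].
Qed.

Lemma locally_connected_quotient : exists (Z : topologicalType) (g : Cplx R -> Z),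
  [/\ lc_continuum Z, monotone_on Q g, g @` Q = setT &
    forall x y, Q x -> Q y -> g x = g y -> f x = f y].
Proof.
have [x0 Qx0] := Q0.
pose Z : topologicalType := final_image Q e.
pose g : Cplx R -> Z := final_map e Qx0.
have cg : {within Q, continuous g} by exact: final_map_continuous.
have geq x y : Q x -> Q y -> (g x = g y <-> e x = e y) by exact: final_map_eq.
have gsurj : g @` Q = setT by exact: final_map_surj.
have gopen (W : set Z) : open W <->
    forall x, Q x -> W (g x) -> \forall y \near x, Q y -> W (g y).
  exact: final_openP.
have ginv (z : Z) : exists2 x, Q x & g x = z by have : [set: Z] z by []; rewrite -gsurj.
have gimp w x y : Sg w -> imp w x -> imp w y -> g x = g y.
  move=> Sw wx wy; apply/geq; [exact: impQ wx|exact: impQ wy|exact: imp_fibre wx wy].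
have hZ : hausdorff_space Z.
  rewrite open_hausdorff => z1 z2; have [x Qx <-] := ginv z1; have [y Qy <-] := ginv z2.
  move=> /eqP gxy; have exy : e x <> e y by move=> exy; apply: gxy; apply/geq.
  have [D1 [D2 [D1x D2y D12 D]]] := fibre_component_separation cQ cf Qx Qy exy.
  pose W D := [set z : Z | exists2 x, Q x /\ D x & g x = z].
  have oW D' : D' = D1 \/ D' = D2 -> open (W D').
    move=> /D[Do Ds]; apply/gopen => u Qu [v [Qv Dv] gvu].
    have Du : D' u.
      by apply: (Ds v) => //; rewrite (geq _ _ Qv Qu).1//; exact: fibre_component_refl.
    by apply: filterS (Do u Qu Du) => u' h Qu'; exists u' => //; split => //; exact: h.
  exists (W D1, W D2) => /=; first by split; rewrite inE; [exists x|exists y].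
  split; [by apply: oW; left|by apply: oW; right|].
  apply/eqP; rewrite -subset0 => z [[u [Qu D1u] <-] [v [Qv D2v] gvu]].
  apply: (D12 u Qu); split => //; have [_ Ds] := D D2 (or_intror erefl).
  by apply: (Ds v) => //; rewrite (geq _ _ Qv Qu).1//; exact: fibre_component_refl.
have lcZ : locally_connected_space Z.
  move=> z N; rewrite nbhsE => -[N' [oN' N'z] N'N].
  pose V := connected_component N' z.
  exists V; split; last 3 first.
  - exact: component_connected.
  - exact: connected_component_refl.
  - by apply: subset_trans N'N; exact: connected_component_sub.
  (* A small connected piece of [Sg] around [w] is mapped into [N'] and meets [V], hence is mapped
     into the component [V]. *)
  have nearV w p : Sg w -> imp w p -> V (g p) ->
      \forall w' \near w, Sg w' -> forall p', imp w' p' -> V (g p').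
    move=> Sw wp Vp.
    have N'p : N' (g p) by exact: connected_component_sub Vp.
    have nO := imp_usc (P := fun y => N' (g y)) Sw.
    have {}nO : \forall w' \near w, Sg w' -> imp w' `<=` (fun y => N' (g y)).
      apply: nO => x wx; move/gopen : oN'; apply; first exact: impQ wx.
      by rewrite -(gimp w p x).
    have [A' [S [nA' cS A'S SA]]] := Sg_lc Sw nO.
    (* The point picked in [imp w'] is irrelevant because [g] is constant there. *)
    pose kappa w' := g (xget x0 (imp w')).
    have kE w' p' : Sg w' -> imp w' p' -> kappa w' = g p'.
      by move=> Sw' w'p'; apply: (gimp w') => //; apply: xgetPex; exists p'.
    have ck : {within S, continuous kappa}.
      apply/subspace_continuousP => u Su; have [_ Sgu] := SA u Su.
      have [q uq] := imp0 Sgu.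
      change (nbhs (kappa u) `<=` (kappa @ within S (nbhs u))).
      rewrite (kE u q)// => B; rewrite nbhsE => -[B' [oB' B'q] B'B].
      have := imp_usc (P := fun y => B' (g y)) Sgu.
      move=> /(_ _)/filterS; apply => [u' h Su'|x ux].
        have [_ Sgu'] := SA u' Su'; have [q' u'q'] := imp0 Sgu'.
        by rewrite /= (kE u' q')//; apply: B'B; exact: h.
      move/gopen : oB'; apply; first exact: impQ ux.
      by rewrite -(gimp u q x).
    have Sw' : S w by apply: A'S; split => //; exact: nbhs_singleton.
    have kV : kappa @` S `<=` V.
      rewrite /V (same_connected_component Vp).
      apply: connected_component_max.
      - by exists w => //; exact: kE.
      - move=> _ [u /SA[h Sgu] <-]; have [q uq] := imp0 Sgu; rewrite (kE u q)//.
        exact: h.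
      - exact: connected_continuous_connected.
    apply: filterS nA' => u A'u Sgu q uq; apply: kV; exists u; last exact: kE.
    by apply: A'S.
  (* By compactness of [Sg] it suffices to look near one [w]: either [x] is in [imp w] and [nearV]
     applies, or points near [x] avoid [imp w'] for [w'] near [w]. *)
  apply/gopen => x Qx Vx; move/compact_near_coveringP : (cSg) => ncS.
  have := ncS (Cplx R) (nbhs x) (fun y w => Sg w -> imp w y -> V (g y)).
  move=> /(_ _ _)/filterS; apply => [y h Qy|w Sw].
    by have [w Sw wy] := imp_cover Qy; exact: (h w).
  have [wx|nwx] := pselect (imp w x).
    exists ([set w' | Sg w' -> forall p', imp w' p' -> V (g p')], setT).
      by split; [exact: nearV wx Vx|exact: filterT].
    by move=> [w' y] [/= h _] Sw'; exact: h.
  have [A [B [wA xB AB]]] := imp_not_near Sw nwx.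
  exists (A, B) => // -[w' y] [/= Aw' By] Sw' w'y.
  by suff : (imp w' `&` B) y by rewrite AB.
exists Z, g; split => //.
- split => //.
  + by exists (g x0).
  + by rewrite -gsurj; exact: continuous_compact.
  + by rewrite -gsurj; exact: connected_continuous_connected.
- split => // z; have [x Qx <-] := ginv z.
  rewrite (_ : _ `&` _ = e x); first exact: component_connected.
  apply/seteqP; split => [y [Qy /= /(geq _ _ Qy Qx) exy]|y].
    by rewrite -exy; exact: fibre_component_refl.
  move=> /[dup] /fibre_component_sub[Qy _] /fibre_component_eq exy; split => //.
  by apply/geq.
- by move=> x y Qx Qy /(geq _ _ Qx Qy); exact: fibre_component_eqf.
Qed.

End LocallyConnectedQuotient.

(** * Sectors *)

Section Sectors.
Variable R : realType.
Implicit Types (w z : Cplx R) (r s : R).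

Definition secant s : R := Num.sqrt (1 + s ^+ 2).

Lemma secant_ge1 s : 1 <= secant s.
Proof. by rewrite -[X in X <= _]sqrtr1 ler_wsqrtr// lerDl sqr_ge0. Qed.

Lemma secant_gt0 s : 0 < secant s.
Proof. exact: lt_le_trans ltr01 (secant_ge1 s). Qed.

Lemma secant_le s : secant s <= 1 + `|s|.
Proof.
rewrite -[X in _ <= X]ger0_norm ?addr_ge0// -sqrtr_sqr; apply: ler_wsqrtr.
by rewrite sqrrD expr1n real_normK ?num_real// lerD2r lerDl mulrn_wge0// mulr_ge0.
Qed.

Lemma secant_continuous : continuous secant.
Proof.
move=> s; apply: (@continuous_comp _ _ _ (fun s => 1 + s ^+ 2) (@Num.sqrt R)).
  by apply: cvgD; [exact: cvg_cst|exact: exprn_continuous].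
exact: sqrt_continuous.
Qed.

(* Polar coordinates around [w], with the slope [s] in place of the angle. *)
Definition polar w r s : Cplx R := w * (r / secant s +i* (r * s / secant s)).

Lemma polar_normc w r s : normc w = 1 -> 0 <= r -> normc (polar w r s) = r.
Proof.
move=> w1 r0; rewrite /polar normcM w1 mul1r /normc.
have s0 := secant_gt0 s.
rewrite (_ : _ + _ = r ^+ 2); first by rewrite sqrtr_sqr ger0_norm.
rewrite !expr_div_n -mulrDl exprMn -[X in X + _]mulr1 -mulrDr sqr_sqrtr.
  by rewrite mulfK// gt_eqF// ltr_wpDr// sqr_ge0.
by rewrite addr_ge0// sqr_ge0.
Qed.

(** Move radially to the unit circle, then along it from slope [s] to slope 0. *)
Lemma polar_near w r s : normc w = 1 -> 1 <= r -> normc (polar w r s - w) <= (r - 1) + 2 * `|s|.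
Proof.
move=> w1 r1; have s0 := secant_gt0 s; have s1 := secant_ge1 s; have sl := secant_le s.
apply: le_trans (normc_distD _ (polar w 1 s) _) _; apply: lerD.
  rewrite (_ : polar w r s - polar w 1 s = polar w (r - 1) s).
    by rewrite polar_normc// subr_ge0.
  rewrite /polar -mulrBr; congr (_ * _); apply/eqP; rewrite eq_complex /=.
  by apply/andP; split; apply/eqP; field; rewrite gt_eqF.
rewrite (_ : polar w 1 s - w = w * (((secant s)^-1 - 1) +i* (s / secant s))); last first.
  rewrite /polar -[X in _ - X]mulr1 -mulrBr; congr (_ * _); apply/eqP; rewrite eq_complex /=.
  by rewrite !mul1r subr0 !eqxx.
rewrite normcM w1 mul1r; apply: le_trans (normc_le_ReIm _) _ => /=.
have i1 : (secant s)^-1 <= 1 by rewrite invf_le1.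
have i0 : 0 < (secant s)^-1 by rewrite invr_gt0.
have h1 : `|(secant s)^-1 - 1| <= `|s|.
  rewrite ler0_norm ?subr_le0// opprB.
  have -> : 1 - (secant s)^-1 = (secant s - 1) / secant s by field; rewrite gt_eqF.
  by rewrite ler_pdivrMr// -[X in X <= _]mulr1; apply: ler_pM => //; lra.
have h2 : `|s / secant s| <= `|s| by rewrite normrM normfV (gtr0_norm s0) ler_piMr.
by lra.
Qed.

Lemma normc1_neq0 w : normc w = 1 -> w != 0.
Proof.
move=> w1; apply/eqP => w0; move: w1; rewrite w0 normc0 => /esym/eqP.
by rewrite oner_eq0.
Qed.

Lemma polar_surj w z : normc w = 1 -> 0 < complex.Re (z / w) ->
  z = polar w (normc z) (complex.Im (z / w) / complex.Re (z / w)).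
Proof.
move=> w1; have w0 := normc1_neq0 w1.
set v := z / w => v0; have zE : z = w * v by rewrite /v mulrC divfK.
rewrite {1 2}zE /polar normcM w1 mul1r; congr (_ * _).
case: v v0 {zE} => a b /= a0.
have s0 := secant_gt0 (b / a).
have nE : Num.sqrt (a ^+ 2 + b ^+ 2) = a * secant (b / a).
  rewrite /secant -{2}(ger0_norm (ltW a0)) -sqrtr_sqr -sqrtrM ?sqr_ge0//.
  by congr Num.sqrt; field; rewrite gt_eqF.
apply/eqP; rewrite eq_complex /= nE.
by apply/andP; split; apply/eqP; field; rewrite !gt_eqF.
Qed.

Lemma polar_continuous w : continuous (fun p : R * R => polar w p.1 p.2).
Proof.
have cV : continuous (fun p : R * R => (secant p.2)^-1 : R).
  move=> p; apply: cvgV; first by rewrite gt_eqF// secant_gt0.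
  by apply: (@continuous_comp _ _ _ snd secant); [exact: cvg_snd|exact: secant_continuous].
have cp : continuous (fun p : R * R => (p.1 / secant p.2, p.1 * p.2 / secant p.2) : R * R).
  have c1 : continuous (fun p : R * R => p.1 / secant p.2).
    by move=> p; apply: cvgM; [exact: cvg_fst|exact: cV].
  have c2 : continuous (fun p : R * R => p.1 * p.2 : R).
    by move=> p; apply: cvgM; [exact: cvg_fst|exact: cvg_snd].
  have c3 : continuous (fun p : R * R => p.1 * p.2 / secant p.2).
    by move=> p; apply: cvgM; [exact: c2|exact: cV].
  by move=> p; exact: (cvg_pair (c1 p) (c3 p)).
move=> p; apply: (@continuous_comp _ _ _ (fun p : R * R => (p.1 / secant p.2 +i*
  (p.1 * p.2 / secant p.2) : Cplx R)) (fun z : Cplx R => w * z)).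
  apply: (@continuous_comp _ _ _ (fun p : R * R => (p.1 / secant p.2, p.1 * p.2 / secant p.2))
    (fun q : R * R => (q.1 +i* q.2 : Cplx R))); first exact: cp.
  exact: Complex_continuous.
exact: (@mulrl_continuous _ (w : R[i])).
Qed.

(** The rectangle is a union of crosses sharing one fixed segment. *)
Lemma connected_rectangle (I J : set R) (U : topologicalType) (h : R * R -> U) :
  is_interval I -> is_interval J -> I !=set0 -> J !=set0 -> continuous h ->
  connected (h @` (I `*` J)).
Proof.
move=> iI iJ [i0 Ii0] [j0 Jj0] ch.
have -> : h @` (I `*` J) = \bigcup_(i in I)
    ((fun j => h (i, j)) @` J `|` (fun i => h (i, j0)) @` I).
  apply/seteqP; split => [_ [[i j] [/= Ii Jj] <-]|_ [i Ii [[j Jj <-]|[i' Ii' <-]]]].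
  - by exists i => //; left; exists j.
  - by exists (i, j).
  - by exists (i', j0).
apply: bigcup_connected.
  by exists (h (i0, j0)) => i Ii; right; exists i0.
move=> i Ii; apply: connectedU.
- by exists (h (i, j0)); split; [exists j0|exists i].
- apply: connected_continuous_connected; first exact/connected_intervalP.
  apply: continuous_subspaceT => j.
  apply: (@continuous_comp _ _ _ (fun j => (i, j)) h); last exact: ch.
  exact: (cvg_pair (cvg_cst i) cvg_id).
- apply: connected_continuous_connected; first exact/connected_intervalP.
  apply: continuous_subspaceT => j.
  apply: (@continuous_comp _ _ _ (fun j => (j, j0)) h); last exact: ch.
  exact: (cvg_pair cvg_id (cvg_cst j0)).
Qed.

Lemma near_slope w (d : R) : normc w = 1 -> 0 < d -> \forall z \near w,
  [/\ 0 < complex.Re (z / w), `|complex.Im (z / w) / complex.Re (z / w)| < d &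
      normc z < 1 + d].
Proof.
move=> w1 d0; pose e := Num.min (2^-1) (d / 2).
have e0 : 0 < e by rewrite lt_min invr_gt0 divr_gt0// ltr0n.
have e1 : e <= 2^-1 by rewrite ge_min lexx.
have e2 : e <= d / 2 by rewrite ge_min lexx orbT.
have w0 := normc1_neq0 w1.
apply/nbhs_normcP; exists e => // z zw.
have vw : normc (z / w - 1) < e.
  by rewrite -(divff w0) -mulrBl normcM normcV w1 invr1 mulr1.
have := le_lt_trans (Re_normc _) vw; have := le_lt_trans (Im_normc _) vw.
rewrite ReB ImB [complex.Im 1]/= [complex.Re 1]/= subr0 => hI.
rewrite ltr_norml => /andP[h1 h2] /=.
have r0 : 2^-1 < complex.Re (z / w).
  by move: h1; lra.
have r0' : 0 < complex.Re (z / w) by apply: lt_trans r0; rewrite invr_gt0.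
split => //.
  rewrite normrM normfV (gtr0_norm r0') ltr_pdivrMr//.
  apply: lt_le_trans hI _; apply: le_trans e2 _.
  by rewrite ler_pM2l// ltW.
have := normc_distD z w 0; rewrite !subr0 w1; lra.
Qed.

(** Radii in []1, 1 + d[] and slopes in []-d, d[] form a connected sector; [d = e / 3] fits the
    bound of [polar_near]. *)
Lemma sector_basis w (A : set (Cplx R)) : normc w = 1 -> nbhs w A -> exists A' S,
  [/\ nbhs w A', connected S, A' `&` [set z | 1 < normc z] `<=` S &
      S `<=` A `&` [set z | 1 < normc z]].
Proof.
move=> w1 /nbhs_normcP[e e0 eA]; pose d := e / 3; have d0 : 0 < d by rewrite divr_gt0.
exists [set z | [/\ 0 < complex.Re (z / w),
  `|complex.Im (z / w) / complex.Re (z / w)| < d & normc z < 1 + d]].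
exists ((fun p : R * R => polar w p.1 p.2) @` (`]1, 1 + d[ `*` `](- d), d[)); split.
- exact: near_slope.
- apply: connected_rectangle; [exact: interval_is_interval|exact: interval_is_interval| | |
    exact: polar_continuous].
    by exists (1 + d / 2); rewrite /= in_itv /=; apply/andP; split; lra.
  by exists 0; rewrite /= in_itv /=; apply/andP; split; lra.
- move=> z [[h1 h2 h3] /= h4]; exists (normc z, complex.Im (z / w) / complex.Re (z / w)).
    by split; rewrite /= in_itv /= -?ltr_norml// h4 h3.
  by rewrite /= -polar_surj.
- move=> _ [[r s] [/= hr hs] <-]; move: hr hs.
  rewrite !in_itv /= -ltr_norml => /andP[r1 rd] sd.
  have r0 : 0 <= r by lra.
  split; last by rewrite /= polar_normc.
  by apply: eA; apply: le_lt_trans (polar_near _ w1 (ltW r1)) _; rewrite /d in rd sd; lra.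
Qed.

(** Local connectedness of the circle: the same argument with the radius fixed at 1. *)
Lemma arc_basis w (A : set (Cplx R)) : normc w = 1 -> nbhs w A -> exists A' S,
  [/\ nbhs w A', connected S, A' `&` [set z | normc z = 1] `<=` S &
      S `<=` A `&` [set z | normc z = 1]].
Proof.
move=> w1 /nbhs_normcP[e e0 eA]; pose d := e / 3; have d0 : 0 < d by rewrite divr_gt0.
exists [set z | [/\ 0 < complex.Re (z / w),
  `|complex.Im (z / w) / complex.Re (z / w)| < d & normc z < 1 + d]].
exists ((fun p : R * R => polar w p.1 p.2) @` ([set 1] `*` `](- d), d[)); split.
- exact: near_slope.
- apply: connected_rectangle; [| exact: interval_is_interval| | |
    exact: polar_continuous].
  + by apply/connected_intervalP; exact: connected1.
  + by exists 1.
  + by exists 0; rewrite /= in_itv /=; apply/andP; split; lra.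
- move=> z [[h1 h2 h3] /= h4]; exists (normc z, complex.Im (z / w) / complex.Re (z / w)).
    by split; rewrite /= ?in_itv /= -?ltr_norml// h4 h3.
  by rewrite /= -polar_surj.
- move=> _ [[r s] [/= -> hs] <-]; move: hs; rewrite in_itv /= -ltr_norml => sd.
  split; last by rewrite /= polar_normc.
  by apply: eA; apply: le_lt_trans (polar_near _ w1 (lexx _)) _; rewrite /d in sd; lra.
Qed.

End Sectors.

(** * The Riemann map and impressions *)

Section RiemannMap.
Variables (R : realType) (Q : set (Cplx R)) (Psi : Cplx R -> Cplx R).
Hypotheses (cQ : compact Q) (uQ : unshielded Q) (rPsi : riemann_map Q Psi).
Implicit Types (z w p : Cplx R).

Lemma psi_continuous z : 1 < normc z -> {for z, continuous Psi}.
Proof.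
move=> z1; have [dPsi _ _ _] := rPsi.
by apply/differentiable_continuous/derivable1_diffP/dPsi; rewrite lt1_normc.
Qed.

Lemma psi_inj z w : 1 < normc z -> 1 < normc w -> Psi z = Psi w -> z = w.
Proof.
by move=> z1 w1; have [_ iPsi _ _] := rPsi; apply: iPsi; rewrite inE /= lt1_normc.
Qed.

Lemma psi_Uinf z : 1 < normc z -> Uinf Q (Psi z).
Proof. by move=> z1; have [_ _ <- _] := rPsi; exists z => //=; rewrite lt1_normc. Qed.

Lemma Uinf_psi p : Uinf Q p -> exists2 z, 1 < normc z & Psi z = p.
Proof. by have [_ _ <- _] := rPsi; move=> [z /=]; rewrite lt1_normc => z1 <-; exists z. Qed.

Lemma psi_growth : exists c M : R, [/\ 0 < c, 1 < M &
  forall z, M < normc z -> c * normc z <= normc (Psi z)].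
Proof.
have [_ _ _ [c [c0 cM]]] := rPsi.
have c20 : 0 < c / 2 by rewrite divr_gt0.
have [M MP] := cM _ c20; exists (c / 2), (Num.max M 2); split => //.
  by rewrite lt_max ltr1n orbT.
move=> z; rewrite gt_max => /andP[Mz z2].
have z0 : 0 < normc z by apply: lt_trans z2.
have := MP z; rewrite norm_normc ltcR => /(_ Mz); rewrite norm_normc ltcR => h.
have : c <= normc (Psi z / z) + normc (Psi z / z - c%:C).
  have := normc_distD (c%:C : Cplx R) (Psi z / z) 0.
  by rewrite !subr0 normc_distC normc_real gtr0_norm// addrC.
rewrite normcM normcV => h2.
by rewrite -ler_pdivlMr//; lra.
Qed.

(** Invariance of domain on a square whose points are within [2 * e] of [z], hence still outside the
    disc of radius [rho]. *)
Lemma psi_open z (rho : R) : 1 <= rho -> rho < normc z -> exists2 eta, 0 < eta &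
  forall y, normc (y - Psi z) < eta -> exists2 u, rho < normc u & Psi u = y.
Proof.
move=> rho1 rhoz; pose e := (normc z - rho) / 3.
have e0 : 0 < e by rewrite divr_gt0// subr_gt0.
have sq u : square z e u -> rho < normc u.
  move=> [uR uI]; have := normc_le_ReIm (u - z); have := normc_distD z u 0.
  by rewrite !subr0 (normc_distC z); rewrite /e in uR uI *; lra.
have sq1 u : square z e u -> 1 < normc u by move=> /sq; exact: le_lt_trans.
have [|u v /sq1 u1 /sq1 v1|eta eta0 h] := @invariance_of_domain _ Psi z e e0.
- by move=> u /sq1; exact: psi_continuous.
- exact: psi_inj.
by exists eta => // y /h[u /sq ? ?]; exists u.
Qed.

(* Near the origin [z |-> 1 / Psi (1 / z)] is a continuous injection fixing [0],
   so its image covers a neighbourhood of infinity. *)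
Lemma psi_bounded : exists r M : R, 1 < r /\
  forall z, 1 < normc z -> normc z < r -> normc (Psi z) <= M.
Proof.
have [c [M [c0 M1 cM]]] := psi_growth.
have M0 : 0 < M by apply: lt_trans M1.
(* Points of the square have norm at most [2 * e < M^-1], so their inverses lie beyond [M], where
   the growth bound holds. *)
pose e := M^-1 / 3; have e0 : 0 < e by rewrite divr_gt0// invr_gt0.
pose h (z : Cplx R) : Cplx R := if z == 0 then 0 else (Psi z^-1)^-1.
have sqV z : z != 0 -> square 0 e z -> M < normc z^-1.
  move=> z0 [zR zI]; rewrite normcV; have n0 : 0 < normc z.
    by rewrite lt_def normc_ge0 andbT; apply: contra z0 => /eqP/eq0_normc/eqP.
  rewrite -[M]invrK ltf_pV2 ?posrE ?invr_gt0//.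
  have := normc_le_ReIm z; rewrite !subr0 in zR zI.
  have : 0 < M^-1 by rewrite invr_gt0.
  by rewrite /e in zR zI *; lra.
have psi0 z : M < normc z -> Psi z != 0.
  move=> zM; apply/eqP => p0; have := cM z zM; rewrite p0 normc0 pmulr_rle0//.
  by rewrite leNgt (lt_trans M0 zM).
have [z sz|z w sz sw|eta eta0 H] := @invariance_of_domain _ h 0 e e0.
- have [->|z0] := eqVneq z 0.
    have h00 : h 0 = 0 by rewrite /h eqxx.
    move=> A; rewrite /= h00 => /nbhs_normcP[d d0 dA].
    apply/nbhs_normcP; exists (Num.min e (d * c)); first by rewrite lt_min e0 mulr_gt0.
    move=> w; rewrite subr0 lt_min => /andP[we wd]; apply: dA; rewrite subr0.
    rewrite /h; case: eqVneq => [_|w0]; first by rewrite normc0.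
    have sw : square 0 e w.
      by split; rewrite subr0; apply/ltW; apply: le_lt_trans we;
        [exact: Re_normc|exact: Im_normc].
    have n0 : 0 < normc w.
      by rewrite lt_def normc_ge0 andbT; apply: contra w0 => /eqP/eq0_normc/eqP.
    have := cM _ (sqV _ w0 sw); rewrite normcV => hc.
    have cw0 : 0 < c / normc w by rewrite divr_gt0.
    rewrite normcV; apply: le_lt_trans (_ : (c / normc w)^-1 < _).
      by rewrite lef_pV2// posrE; apply: lt_le_trans hc.
    by rewrite invfM invrK mulrC ltr_pdivrMr.
  have zV := sqV _ z0 sz.
  have hE : {near z, (fun z => (Psi z^-1)^-1) =1 h}.
    apply/nbhs_normcP; exists (normc z).
      by rewrite lt_def normc_ge0 andbT; apply: contra z0 => /eqP/eq0_normc/eqP.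
    move=> u uz; rewrite /h; case: eqVneq uz => // ->.
    by rewrite normc_distC subr0 ltxx.
  have hz : h z = (Psi z^-1)^-1 by rewrite /h (negbTE z0).
  change (h u @[u --> z] --> h z); rewrite hz; apply: cvg_trans; first exact: near_eq_cvg hE.
  apply: (@cvgV R[i]); first exact: psi0.
  apply: (@continuous_comp _ _ _ (fun z : Cplx R => z^-1 : Cplx R) Psi).
    exact: (@inv_continuous R[i] z z0).
  by apply: psi_continuous; exact: lt_trans zV.
- rewrite /h; case: eqVneq => [->|z0]; case: eqVneq => [->|w0]//.
  + by move=> /esym/eqP; rewrite invr_eq0 (negbTE (psi0 _ (sqV _ w0 sw))).
  + by move=> /eqP; rewrite invr_eq0 (negbTE (psi0 _ (sqV _ z0 sz))).
  + move=> /invr_inj/psi_inj zw; apply: invr_inj; apply: zw.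
      exact: lt_trans (sqV _ z0 sz).
    exact: lt_trans (sqV _ w0 sw).
(* A value of norm above [eta^-1] is taken at a point of norm above [M], hence, by injectivity, at
   no point of norm below [M]. *)
exists M, eta^-1; split => // z z1 zM; rewrite leNgt; apply/negP => zeta.
have p0 : 0 < normc (Psi z) by apply: lt_trans zeta; rewrite invr_gt0.
have [|u su hu] := H (Psi z)^-1.
  rewrite /h eqxx subr0 normcV -[eta]invrK ltf_pV2// posrE invr_gt0//.
have u0 : u != 0.
  apply/eqP => u0; move: hu; rewrite u0 /h eqxx => /esym/eqP; rewrite invr_eq0 => /eqP pz.
  by move: p0; rewrite pz normc0 ltxx.
move: hu; rewrite /h (negbTE u0) => /invr_inj/psi_inj uz.
have uM := sqV _ u0 su; move: zM; rewrite -uz//; last exact: lt_trans uM.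
by move/(lt_trans uM); rewrite ltxx.
Qed.

(** Points of norm above [r] already take all values near [p], so by injectivity points of norm
    below [r] have values away from [p]. *)
Lemma psi_avoid p : Uinf Q p -> exists r eta : R, [/\ 1 < r, 0 < eta &
  forall z, 1 < normc z -> normc z < r -> eta <= normc (Psi z - p)].
Proof.
move=> /Uinf_psi[z0 z01 <-]; pose r := (1 + normc z0) / 2.
have r1 : 1 <= r by rewrite /r; lra.
have rz : r < normc z0 by rewrite /r; lra.
have [eta eta0 h] := psi_open r1 rz.
exists r, eta; split => //; first by rewrite /r; lra.
move=> z z1 zr; rewrite leNgt; apply/negP => /h[u ru /psi_inj uz].
move: zr; rewrite -uz//; last exact: le_lt_trans ru.
by move/(lt_trans ru); rewrite ltxx.
Qed.

Lemma Uinf_disjoint p : Uinf Q p -> ~ Q p.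
Proof. by case. Qed.

Lemma closure_Uinf p : closure (Uinf Q) p -> Uinf Q p \/ Q p.
Proof.
move=> clp; have [ip|ip] := pselect (interior (Uinf Q) p).
  by left; exact: interior_subset ip.
by right; rewrite uQ.
Qed.

Lemma sub_closure_Uinf : Q `<=` closure (Uinf Q).
Proof. by move=> p; rewrite {1}uQ => -[]. Qed.

Lemma impressionP w p : impression Psi w p <->
  forall A B, nbhs w A -> nbhs p B -> exists z, [/\ 1 < normc z, A z & B (Psi z)].
Proof.
split=> [[u [u1 uw up]] A B wA pB|h].
  have nAB : \forall n \near \oo, A (u n) /\ B (Psi (u n)).
    by near=> n; split; near: n; [exact: uw wA|exact: up pB].
  have [n [An Bn]] := filter_ex nAB.
  by exists (u n); split => //; rewrite -lt1_normc.
have /choice[u uP] : forall n : nat, exists z, [/\ 1 < normc z,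
    normc (z - w) < n.+1%:R^-1 & normc (Psi z - p) < n.+1%:R^-1].
  move=> n; have n0 : 0 < n.+1%:R^-1 :> R by rewrite invr_gt0.
  exact: h (near_normc w n0) (near_normc p n0).
exists u; split.
- by move=> n; rewrite lt1_normc; have [] := uP n.
- apply: cvg_complexP => e e0; near=> n.
  have [_ h1 _] := uP n; apply: lt_trans h1 _; near: n.
  exact: (near_infty_natSinv_lt (PosNum e0)).
- apply: cvg_complexP => e e0; near=> n.
  have [_ _ h1] := uP n; apply: lt_trans h1 _; near: n.
  exact: (near_infty_natSinv_lt (PosNum e0)).
Unshelve. all: by end_near. Qed.

Lemma not_impression w p : ~ impression Psi w p -> exists A B,
  [/\ nbhs w A, nbhs p B & forall z, 1 < normc z -> A z -> ~ B (Psi z)].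
Proof.
move=> nwp; apply: contrapT => h; apply: nwp; apply/impressionP => A B wA pB.
apply: contrapT => h'; apply: h; exists A, B; split => // z z1 Az Bz.
by apply: h'; exists z.
Qed.

Lemma impression_closed_graph w p :
  (forall A B, nbhs w A -> nbhs p B -> exists2 w',
     A w' & impression Psi w' `&` B !=set0) -> impression Psi w p.
Proof.
move=> h; apply/impressionP => A B; rewrite !nbhsE => -[A' oA A'A] [B' oB B'B].
have [w' A'w' [p' [/impressionP w'p' B'p']]] := h _ _ (open_nbhs_nbhs oA) (open_nbhs_nbhs oB).
have [z [z1 Az Bz]] := w'p' A' B' (open_nbhs_nbhs (conj oA.1 A'w'))
  (open_nbhs_nbhs (conj oB.1 B'p')).
by exists z; split => //; [exact: A'A|exact: B'B].
Qed.

(** Limits of [Psi] lie in the closure of [Uinf Q], and [psi_avoid] excludes those in [Uinf Q]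
    itself. *)
Lemma impression_sub w : normc w = 1 -> impression Psi w `<=` Q.
Proof.
move=> w1 p /impressionP wp.
have [|Up|//] := @closure_Uinf p.
  move=> B pB; have [z [z1 _ Bz]] := wp setT B filterT pB.
  by exists (Psi z); split => //; exact: psi_Uinf.
exfalso; have [r [eta [r1 eta0 h]]] := psi_avoid Up.
have nr : nbhs w [set z | normc z < r].
  have d0 : 0 < r - 1 by rewrite subr_gt0.
  apply: filterS (near_normc w d0) => z zw /=.
  by have := normc_distD z w 0; rewrite !subr0 w1; lra.
have [z [z1 zr]] := wp _ _ nr (near_normc p eta0).
by rewrite /= ltNge h.
Qed.

Lemma near_circle_lt w (r : R) : normc w = 1 -> 1 < r -> \forall z \near w, normc z < r.
Proof.
move=> w1 r1; have d0 : 0 < r - 1 by rewrite subr_gt0.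
apply/nbhs_normcP; exists (r - 1) => // z zw.
by have := normc_distD z w 0; rewrite !subr0 w1; lra.
Qed.

(** Near the circle the values of [Psi] stay in a compact disc, each point of which is either in the
    impression, so interior to [O], or not approached as [z] tends to [w]. *)
Lemma impression_usc w (O : set (Cplx R)) : normc w = 1 ->
  (forall p, impression Psi w p -> nbhs p O) ->
  \forall z \near w, 1 < normc z -> O (Psi z).
Proof.
move=> w1 wO; have [r [M [r1 rM]]] := psi_bounded.
have /compact_near_coveringP nc := @compact_disc R M.
have key : \forall z \near w, [set y | normc y <= M] `<=`
    (fun p => 1 < normc z -> Psi z = p -> O p).
  apply: (nc (Cplx R) (nbhs w) (fun z p => 1 < normc z -> Psi z = p -> O p)) => p _.
  have [wp|/not_impression[A [B [wA pB AB]]]] := pselect (impression Psi w p).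
    exists (O, setT); first by split; [exact: wO|exact: filterT].
    by move=> [p' z] [/= Op' _] _ _.
  by exists (B, A) => // -[p' z] [/= Bp' Az] z1 pE; case: (AB z z1 Az); rewrite pE.
near=> z => z1.
have zr : normc z < r by near: z; exact: near_circle_lt.
have h : [set y | normc y <= M] `<=` (fun p => 1 < normc z -> Psi z = p -> O p) by near: z.
by apply: (h (Psi z)) => //; exact: rM.
Unshelve. all: by end_near. Qed.

End RiemannMap.

(** * Impressions, rays and cuts *)

Section Impressions.
Variables (R : realType) (Q : set (Cplx R)) (Psi : Cplx R -> Cplx R).
Hypotheses (cQ : compact Q) (uQ : unshielded Q) (rPsi : riemann_map Q Psi).
Implicit Types (z w p : Cplx R) (C Th A B : set (Cplx R)).

Lemma impression_closed w : closed (impression Psi w).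
Proof.
move=> p clp; apply: impression_closed_graph => A B wA pB.
by exists w; [exact: nbhs_singleton|exact: clp].
Qed.

(** If the impression split into two parts, [Psi] would map a small connected sector at [w] into the
    union of disjoint neighbourhoods of them, hence into one, although both parts are approached. *)
Lemma impression_connected w : normc w = 1 -> connected (impression Psi w).
Proof.
move=> w1; have iQ := impression_sub uQ rPsi w1.
apply/connectedP => E [E0 iE [sE1 sE2]].
have cE b : compact (E b).
  have Ei : E b `<=` impression Psi w by rewrite iE; case: b => ? ?; [right|left].
  apply: (subclosed_compact _ cQ); last exact: subset_trans iQ.
  move=> p clp; have : impression Psi w p.
    by apply: impression_closed; apply: closureS clp.
  rewrite iE; case: b clp {Ei} => clp [Ep|Ep] //.
    by suff : (E false `&` closure (E true)) p by rewrite sE2.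
  by suff : (closure (E false) `&` E true) p by rewrite sE1.
have [|W [W' [oW oW' EW EW' WW']]] := compact_disjoint_open (cE false) (cE true).
  by rewrite -subset0 => p [/subset_closure ? ?]; rewrite -sE1.
have nW : \forall z \near w, 1 < normc z -> (W `|` W') (Psi z).
  apply: (impression_usc (Q := Q)) => // p; rewrite iE => -[/EW Wp|/EW' Wp].
    by apply: open_nbhs_nbhs; split; [exact: openU|left].
  by apply: open_nbhs_nbhs; split; [exact: openU|right].
have [A [S [wA cS AS SA]]] := sector_basis w1 nW.
have cPS : connected (Psi @` S).
  apply: connected_continuous_connected => //.
  apply/subspace_continuousP => z /SA[_ z1].
  by apply: cvg_within_filter; exact: (psi_continuous rPsi z1).
have no (D D' : set (Cplx R)) p : open D' -> D `&` D' = set0 -> D' p -> impression Psi w p ->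
    ~ (Psi @` S `<=` D).
  move=> oD' DD' D'p /impressionP wp SD.
  have [z [z1 Az D'z]] := wp _ _ wA (open_nbhs_nbhs (conj oD' D'p)).
  suff : (D `&` D') (Psi z) by rewrite DD'.
  by split => //; apply: SD; exists z => //; exact: AS.
have [||] := connected_subset (separated_open oW oW' WW') _ cPS.
- by move=> _ [z /SA[h z1] <-]; exact: h.
- have [p Ep] := E0 true; apply: (no _ W' p) => //; first exact: EW'.
  by rewrite iE; right.
- have [p Ep] := E0 false; apply: (no _ W p) => //; first by rewrite setIC.
    exact: EW.
  by rewrite iE; left.
Qed.

(** Points [z] with [Psi z] tending to [p] stay bounded by the growth of [Psi], so they have a
    cluster point [w]. If [normc w > 1], then [Psi w = p] would be in [Uinf Q]. *)
Lemma impression_cover : Q `<=` \bigcup_(w in [set w | normc w = 1]) impression Psi w.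
Proof.
move=> p Qp; have [c [M [c0 M1 cM]]] := psi_growth rPsi.
pose F := filter_from (nbhs p) (fun B => [set z | 1 < normc z /\ B (Psi z)]).
have FF : ProperFilter F.
  apply: filter_from_proper.
    apply: filter_from_filter; first by exists setT; exact: filterT.
    move=> A B pA pB; exists (A `&` B); first exact: filterI.
    by move=> z [z1 [Az Bz]]; split.
  move=> B pB; have [q [Uq Bq]] := sub_closure_Uinf uQ Qp pB.
  by have [z z1 zq] := Uinf_psi rPsi Uq; exists z; split => //=; rewrite zq.
pose M2 := Num.max M ((normc p + 1) / c).
have [|w [_ Fw]] := @compact_disc R M2 F FF.
  exists [set q | normc (q - p) < 1]; first exact: near_normc.
  move=> z [z1 /= zp]; rewrite /M2 le_max; have [//|Mz] := lerP (normc z) M.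
  rewrite /= ler_pdivlMr// mulrC; apply: le_trans (cM z Mz) _.
  by have := normc_distD (Psi z) p 0; rewrite !subr0; lra.
have wp A B : nbhs w A -> nbhs p B -> exists z, [/\ 1 < normc z, A z & B (Psi z)].
  move=> wA pB; have [|z [[z1 Bz] Az]] := Fw [set z | 1 < normc z /\ B (Psi z)] A _ wA.
    by exists B.
  by exists z.
exists w; last exact/impressionP.
rewrite /=; case: (ltgtP (normc w) 1) => // w1; exfalso.
  have d0 : 0 < 1 - normc w by rewrite subr_gt0.
  have [z [z1 zw _]] := wp _ _ (near_normc w d0) (@filterT _ (nbhs p) _).
  by have := normc_distD z w 0; rewrite !subr0; lra.
have Pw : Psi w <> p.
  by move=> wE; case: (psi_Uinf rPsi w1) => /= + _; rewrite wE.
have d0 : 0 < normc (Psi w - p) / 2.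
  rewrite divr_gt0// lt_def normc_ge0 andbT; apply/eqP => /eq0_normc/eqP.
  by rewrite subr_eq0 => /eqP.
have [z [_ zw zp]] := wp _ _ (psi_continuous rPsi w1 (near_normc _ d0)) (near_normc p d0).
have := normc_distD (Psi w) (Psi z) p; rewrite (normc_distC (Psi w) (Psi z)).
by move: zw zp => /=; lra.
Qed.

Lemma normc_ray w (r : R) : normc w = 1 -> 1 < r -> normc (r%:C * w) = r.
Proof. by move=> w1 r1; rewrite normcM w1 mulr1 normc_real gtr0_norm//; lra. Qed.

Lemma acc_nonempty w : normc w = 1 -> acc_set Psi w !=set0.
Proof.
move=> w1; have [r [M [r1 rM]]] := psi_bounded rPsi.
have [|p [_ pF]] := @compact_disc R M ((fun s : R => Psi (s%:C * w)) @ (1:R)^'+) _.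
  change (\forall s \near (1:R)^'+, normc (Psi (s%:C * w)) <= M).
  apply: filterS2 (nbhs_right_gt 1) (nbhs_right_lt r1) => s s1 sr.
  by apply: rM; rewrite normc_ray.
by exists p.
Qed.

Lemma acc_sub_impression w : normc w = 1 -> acc_set Psi w `<=` impression Psi w.
Proof.
move=> w1 p pF; apply/impressionP => A B /nbhs_normcP[e e0 eA] pB.
have e1 : 1 < 1 + e by rewrite ltrDl.
have [|_ [[s [s1 sA] <-] Bs]] := pF [set Psi (s%:C * w) | s in [set s | 1 < s /\ A (s%:C * w)]] B _ pB.
  change (\forall s \near (1:R)^'+,
    [set Psi (s%:C * w) | s in [set s | 1 < s /\ A (s%:C * w)]] (Psi (s%:C * w))).
  apply: filterS2 (nbhs_right_gt 1) (nbhs_right_lt e1) => s s1 se; exists s => //.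
  split => //; apply: eA; rewrite -[X in _ - X]mul1r -mulrBl normcM w1 mulr1.
  rewrite (_ : s%:C - 1 = (s - 1)%:C); last by apply/eqP; rewrite eq_complex /= subr0 !eqxx.
  by rewrite normc_real ger0_norm ?subr_ge0 ?ltW// ltrBlDl.
by exists (s%:C * w); split => //; rewrite normc_ray.
Qed.

Lemma impression_nonempty w : normc w = 1 -> impression Psi w !=set0.
Proof.
move=> w1; have [p pw] := acc_nonempty w1; exists p; exact: acc_sub_impression pw.
Qed.

Lemma unit_circleP w : unit_circle w -> normc w = 1.
Proof. by rewrite /unit_circle /= norm_normc => /complexI. Qed.

Lemma tilde_Q C Th p : ray_compactum Q Psi C Th -> Q p -> tilde Psi C Th p -> C p.
Proof.
move=> [_ [_ Th1] _ _] Qp [//|[w /Th1/unit_circleP w1 [r r1 rp]]]; exfalso.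
have : Uinf Q p by rewrite -rp; apply: psi_Uinf => //; rewrite normc_ray.
by move/Uinf_disjoint.
Qed.

(** If [Psi z] were on the ray of [v], injectivity would put [z] on the half-line through [v], so
    [v] would be at distance [normc z - 1] from [z] and thus close to [w]; but [Th] is closed. *)
Lemma near_not_tilde C Th w : ray_compactum Q Psi C Th -> normc w = 1 -> ~ Th w ->
  \forall z \near w, 1 < normc z -> ~ tilde Psi C Th (Psi z).
Proof.
move=> [[cC CQ] [clTh Th1] _ _] w1 nTh.
have /nbhs_normcP[e e0 eTh] : nbhs w (~` Th).
  by apply: open_nbhs_nbhs; split => //; exact: closed_openC.
have e20 : 0 < e / 2 by rewrite divr_gt0.
apply/nbhs_normcP; exists (e / 2) => // z zw z1 [/CQ Qz|[v Thv [r r1 rz]]].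
  by case: (psi_Uinf rPsi z1).
have v1 := unit_circleP (Th1 _ Thv); have nrv := normc_ray v1 r1.
have zE : z = r%:C * v.
  by apply: (psi_inj rPsi) => //; rewrite nrv.
apply: (eTh v) Thv; apply: le_lt_trans (normc_distD _ z _) _.
have -> : normc (v - z) = normc z - 1.
  rewrite zE -{1}[v]mul1r -mulrBl normcM v1 mulr1 nrv.
  rewrite (_ : 1 - r%:C = (1 - r)%:C); last by apply/eqP; rewrite eq_complex /= subr0 !eqxx.
  by rewrite normc_real distrC ger0_norm// subr_ge0 ltW.
by have := normc_distD z w 0; rewrite !subr0 w1; lra.
Qed.

(* [G] and [H] play the roles of one open side of the slice [c] in [Q] and of
   its union with the slice, but [H] need not contain all of [c.1]. *)
Definition is_cut (G H : set (Cplx R)) (c : set (Cplx R) * set (Cplx R)) :=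
  [/\ (forall x, G x -> \forall y \near x, Q y -> G y), closed H,
      G `<=` H /\ H `<=` Q, H `<=` G `|` c.1 &
      forall w, normc w = 1 -> ~ c.2 w -> impression Psi w `&` G !=set0 ->
        impression Psi w `<=` H].

(** The cut consists of [U & Q] and of [Q] minus [V]. *)
Lemma ray_separates_cut c A B : ray_compactum Q Psi c.1 c.2 ->
  ray_separates Q Psi c.1 c.2 A B -> A `<=` Q ->
  exists G H, [/\ is_cut G H c, A `<=` G & B `&` H = set0].
Proof.
move=> rc [U [V [UV AU BV [sUV1 sUV2]]]] AQ.
have [[cC CQ] [clTh Th1] _ _] := rc.
have clQ : closed Q by apply: compact_closed cQ; exact: Cplx_hausdorff.
have clC : closed c.1 by apply: compact_closed cC; exact: Cplx_hausdorff.
have UVn p : U p \/ V p -> ~ tilde Psi c.1 c.2 p.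
  by move=> h; have : (U `|` V) p by []; rewrite -UV => -[].
have UVQ p : Q p -> ~ c.1 p -> U p \/ V p.
  move=> Qp nCp; have : (U `|` V) p; last by [].
  rewrite -UV; split; first exact: sub_closure_Uinf.
  by move=> /(tilde_Q rc Qp).
have disj p : U p -> V p -> False.
  move=> Up Vp; suff : (closure U `&` V) p by rewrite sUV1.
  by split => //; exact: subset_closure.
have nbV p : U p -> nbhs p (~` V).
  move=> Up; apply: contrapT => h; suff : (U `&` closure V) p by rewrite sUV2.
  split => // N pN; apply: contrapT => /nonemptyPn VN.
  by apply: h; apply: filterS pN => q Nq Vq; suff : (V `&` N) q by rewrite VN.
have nbU p : V p -> nbhs p (~` U).
  move=> Vp; apply: contrapT => h; suff : (closure U `&` V) p by rewrite sUV1.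
  split => // N pN; apply: contrapT => /nonemptyPn VN.
  by apply: h; apply: filterS pN => q Nq Uq; suff : (U `&` N) q by rewrite VN.
have nbC p : U p \/ V p -> nbhs p (~` c.1).
  move=> h; apply: open_nbhs_nbhs; split; first exact: closed_openC.
  by move=> Cp; apply: (UVn p h); left.
(* A small sector at [w] is mapped off [tilde], hence by connectedness into [U] or into [V], and the
   impression cannot reach the other side. *)
have side w : normc w = 1 -> ~ c.2 w ->
    (forall p, impression Psi w p -> ~ V p) \/ (forall p, impression Psi w p -> ~ U p).
  move=> w1 nTh; have [N [S [wN cS NS SN]]] := sector_basis w1 (near_not_tilde rc w1 nTh).
  have cPS : connected (Psi @` S).
    apply: connected_continuous_connected => //.
    apply/subspace_continuousP => z /SN[_ z1].
    by apply: cvg_within_filter; exact: (psi_continuous rPsi z1).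
  have SUV : Psi @` S `<=` U `|` V.
    move=> _ [z /SN[h z1] <-]; rewrite -UV; split; last exact: h.
    by apply: subset_closure; exact: psi_Uinf.
  have no (D : set (Cplx R)) p : nbhs p (~` D) -> impression Psi w p -> ~ (Psi @` S `<=` D).
    move=> pD /impressionP wp SD; have [z [z1 Nz]] := wp _ _ wN pD; apply.
    by apply: SD; exists z => //; exact: NS.
  have [SU|SV] := connected_subset (conj sUV1 sUV2) SUV cPS; [left|right] => p wp h.
    exact: (no U p (nbU p h) wp).
  exact: (no V p (nbV p h) wp).
exists (U `&` Q), (Q `&` ~` V); split; last 2 first.
- by move=> x Ax; split; [exact: AU|exact: AQ].
- by rewrite -subset0 => x [/BV Vx [_]].
split.
- move=> x [Ux Qx]; apply: filterS2 (nbV x Ux) (nbC x (or_introl Ux)) => y nV nC Qy.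
  by split => //; have [//|/nV] := UVQ y Qy nC.
- move=> x clx; have Qx : Q x by apply: clQ; apply: closureS clx => y [].
  split => // Vx.
  have [y [[Qy nVy] [nUy nCy]]] := clx _ (filterI (nbU x Vx) (nbC x (or_intror Vx))).
  by have [] := UVQ y Qy nCy.
- by split; [move=> x [Ux Qx]; split => // Vx; exact: (disj x)|move=> x []].
- move=> x [Qx nVx]; have [Cx|nCx] := pselect (c.1 x); first by right.
  by left; have [Ux|] := UVQ x Qx nCx.
- move=> w w1 nTh [p [wp [Up _]]] q wq; split; first exact: (impression_sub uQ rPsi w1).
  by have [h|h] := side w w1 nTh; [exact: h|case: (h p wp)].
Qed.

End Impressions.

(** * Well-slicing families *)

Section WellSlicing.
Variables (R : realType) (Q X : set (Cplx R)) (Psi : Cplx R -> Cplx R).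
Variable F : set (set (Cplx R) * set (Cplx R)).
Hypotheses (cQ : compact Q) (uQ : unshielded Q) (rPsi : riemann_map Q Psi).
Hypotheses (kX : connected X) (XQ : X `<=` Q) (wF : well_slicing Q Psi X F).
Implicit Types (a b c d : set (Cplx R) * set (Cplx R)).

Lemma slice_compactum a : F a -> ray_compactum Q Psi a.1 a.2.
Proof. by have [_ rF _ _ _] := wF; exact: rF. Qed.

(** If [X] missed the slice, it would be covered by [U] and [V], hence lie in one of them, against
    the choice of [x] and [y]. *)
Lemma slice_meets a : F a -> X `&` a.1 !=set0.
Proof.
move=> Fa; have [_ _ _ /(_ _ Fa)[x [y [Xx Xy [U [V [UV xU yV sUV]]]]]] _] := wF.
apply: contrapT => /nonemptyPn Xa.
have XUV : X `<=` U `|` V.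
  move=> z Xz; rewrite -UV; split; first exact/(sub_closure_Uinf uQ)/XQ.
  move=> /(tilde_Q rPsi (slice_compactum Fa) (XQ Xz)) az.
  by suff : (X `&` a.1) z by rewrite Xa.
have UV0 := separated_disjoint sUV.
have [XU|XV] := connected_subset sUV XUV kX.
  suff : (U `&` V) y by rewrite UV0.
  by split; [exact: XU|exact: yV].
suff : (U `&` V) x by rewrite UV0.
by split; [exact: xU|exact: XV].
Qed.

Lemma slice_acc a w : F a -> a.2 w -> normc w = 1 /\ impression Psi w `&` a.1 !=set0.
Proof.
move=> /slice_compactum[_ [_ Th1] aC _] aw; have w1 := unit_circleP (Th1 _ aw).
split => //; have [p wp] := acc_nonempty rPsi w1; exists p.
by split; [exact: acc_sub_impression wp|apply: aC; exists w].
Qed.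

Lemma slice_disjoint a b : F a -> F b -> a <> b -> a.1 `&` b.1 = set0.
Proof. by have [_ _ dF _ _] := wF; exact: dF. Qed.

Lemma slice_angles a b w : F a -> F b -> a <> b -> a.2 w -> ~ b.2 w.
Proof.
move=> Fa Fb ab aw bw; have w1 := (slice_acc Fa aw).1.
have [_ _ aC _] := slice_compactum Fa; have [_ _ bC _] := slice_compactum Fb.
have [p wp] := acc_nonempty rPsi w1.
suff : (a.1 `&` b.1) p by rewrite slice_disjoint.
by split; [apply: aC; exists w|apply: bC; exists w].
Qed.

Lemma slice_sub a : F a -> a.1 `<=` Q.
Proof. by move=> /slice_compactum[[]]. Qed.

Lemma slice_closed a : F a -> closed a.1.
Proof.
by move=> /slice_compactum[[ca _] _ _ _]; apply: compact_closed ca; exact: Cplx_hausdorff.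
Qed.

Local Notation is_cut := (is_cut Q Psi).

(* The slice [d] provided by the family may have pieces beyond [b] or before [a];
   they are discarded by trimming its sides to [(G & G2) | G1] and [(H & H2) | H1]. *)
Lemma cut_interpolation G1 H1 a G2 H2 b : F a -> F b -> a <> b ->
  is_cut G1 H1 a -> is_cut G2 H2 b -> H1 `<=` G2 ->
  exists G H d, [/\ F d, d <> a, d <> b & is_cut G H d] /\ H1 `<=` G /\ H `<=` G2.
Proof.
move=> Fa Fb ab [oG1 cH1 [GH1 HQ1] HG1 iG1] [oG2 cH2 [GH2 HQ2] HG2 iG2] H12.
have [_ _ _ _ /(_ _ _ Fa Fb ab)[d [Fd da db sd]]] := wF.
have [G [H [[oG cH [GH HQ] HG iG] aG bH]]] :=
  ray_separates_cut cQ uQ rPsi (slice_compactum Fd) sd (slice_sub Fa).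
have bnH x : b.1 x -> ~ H x by move=> bx Hx; suff : (b.1 `&` H) x by rewrite bH.
have HH2 : H `&` H2 `<=` G2 by move=> x [Hx /HG2[//|/bnH]].
exists ((G `&` G2) `|` G1), ((H `&` H2) `|` H1), d; split; last first.
  split; last by move=> x [/HH2//|/H12].
  by move=> x H1x; case: (HG1 x H1x) => [|/aG Gx]; [right|left; split => //; exact: H12].
split => //; split.
- move=> x [[Gx G2x]|G1x].
    by apply: filterS2 (oG x Gx) (oG2 x G2x) => y h h2 Qy; left; split; [exact: h|exact: h2].
  by apply: filterS (oG1 x G1x) => y h Qy; right; exact: h.
- by apply: closedU => //; exact: closedI.
- split; last by move=> x [[/HQ]|/HQ1].
  by move=> x [[Gx G2x]|/GH1]; [left; split; [exact: GH|exact: GH2]|right].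
- move=> x [[Hx H2x]|H1x].
    case: (HG x Hx) => [Gx|]; last by right.
    by left; left; split => //; exact: HH2.
  left; case: (HG1 x H1x) => [|/aG Gx]; first by right.
  by left; split => //; exact: H12.
- move=> w w1 nd.
  have inH : impression Psi w `<=` H -> impression Psi w `&` G2 !=set0 ->
      impression Psi w `<=` (H `&` H2) `|` H1.
    (* An angle of [b] would bring a point of [b.1] into the impression, hence into [H], which
       misses [b.1]. *)
    move=> wH w2; have nb : ~ b.2 w.
      by move=> /(slice_acc Fb)[_ [p [wp bp]]]; exact: bnH bp (wH p wp).
    by move=> p wp; left; split; [exact: wH|exact: (iG2 w w1 nb w2)].
  move=> [p [wp [[Gp G2p]|G1p]]].
    by apply: inH; [apply: iG => //; exists p|exists p].
  (* Here the impression meets [G1]. If [w] is not an angle of [a], it stays in [H1]; otherwise it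
     meets [a.1], hence [G], and stays in [H]. *)
  have [aw|naw] := pselect (a.2 w); last first.
    by move=> q wq; right; apply: (iG1 w w1 naw _ q wq); exists p.
  apply: inH; last by exists p; split => //; exact/H12/GH1.
  have [_ [q [wq aq]]] := slice_acc Fa aw.
  by apply: iG => //; exists q; split => //; exact: aG.
Qed.

(** [urysohn_chain] is applied to all cuts along members of [F], its density being
    [cut_interpolation]. The function is 0 on [a.1] and 1 on [b.1], and both meet [X]. *)
Lemma well_slicing_function : exists f : Cplx R -> R,
  [/\ {within Q, continuous f}, exists x y, [/\ X x, X y & f x <> f y] &
    forall w, normc w = 1 -> forall x y, impression Psi w x -> impression Psi w y -> f x = f y].
Proof.
have [[a [b [Fa Fb ab]]] _ _ _ _] := wF.
have clQ : closed Q by apply: compact_closed cQ; exact: Cplx_hausdorff.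
pose I := {i : (set (Cplx R) * set (Cplx R)) * (set (Cplx R) * set (Cplx R)) |
  F i.2 /\ is_cut i.1.1 i.1.2 i.2}.
pose lt (i j : I) := (sval i).2 <> (sval j).2 /\ (sval i).1.2 `<=` (sval j).1.1.
(* The extreme cuts: nothing lies before [a], and all of [Q] outside [b.1] lies before [b]. *)
have cuta : is_cut set0 a.1 a.
  split => //; first exact: slice_closed.
  - by split => //; exact: slice_sub.
  - by move=> w _ _ [? [_ []]].
have cutb : is_cut (Q `\` b.1) Q b.
  split => //.
  - move=> x [Qx nbx]; have : nbhs x (~` b.1).
      by apply: open_nbhs_nbhs; split => //; exact/closed_openC/slice_closed.
    by apply: filterS => y nby Qy; split.
  - by split => // x [].
  - by move=> x Qx; have [bx|nbx] := pselect (b.1 x); [right|left].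
  - by move=> w w1 _ _; exact: (impression_sub uQ rPsi w1).
pose p : I := exist _ ((set0, a.1), a) (conj Fa cuta).
pose q : I := exist _ ((Q `\` b.1, Q), b) (conj Fb cutb).
have abx x : a.1 x -> ~ b.1 x.
  by move=> ax bx; suff : (a.1 `&` b.1) x by rewrite slice_disjoint.
have [|||||| f [cf f0 f1 fP]] := @urysohn_chain R _ Q I (fun i => (sval i).1.1)
    (fun i => (sval i).1.2) lt p q.
- by move=> [[[G H] c] [/= _ []]].
- by move=> [[[G H] c] [/= _ []]].
- by move=> [[[G H] c] [/= _ [_ _ []]]].
- by move=> i j [].
- move=> [[[G H] c] pc] [[[G' H'] c'] pc'] [/= cc' HG].
  have [/= Fc cutc] := pc; have [/= Fc' cutc'] := pc'.
  have [G2 [H2 [d [[Fd dc dc' cutd] [h1 h2]]]]] := cut_interpolation Fc Fc' cc' cutc cutc' HG.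
  by exists (exist _ ((G2, H2), d) (conj Fd cutd)); split; split => //=; exact: nesym.
- by split => // x ax; split; [exact: slice_sub ax|exact: abx].
exists f; split => //.
  have [x [Xx ax]] := slice_meets Fa; have [y [Xy by_]] := slice_meets Fb.
  exists x, y; split => //; rewrite f0// f1; last by move=> [_].
  by move/esym/eqP; rewrite oner_eq0.
move=> w w1; apply: fP => -[[[G H] c] pc] [[[G' H'] c'] pc'] [/= cc' HG] wG.
have [/= Fc [_ _ [GH _] _ iG]] := pc; have [/= Fc' [_ _ [GH' _] _ iG']] := pc'.
(* If [w] is an angle of [c], it is not one of [c'], and the cut along [c'] confines the impression;
   otherwise the cut along [c] does. *)
have [cw|ncw] := pselect (c.2 w).
  apply: (iG' w w1 (slice_angles Fc Fc' cc' cw)).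
  by have [p' [wp' Gp']] := wG; exists p'; split => //; exact/HG/GH.
by apply: subset_trans GH'; apply: subset_trans HG; exact: iG.
Qed.

End WellSlicing.

(** * Factoring through the finest map *)

Theorem theorem3p15 (R : realType) (Q : set (Cplx R)) (Y : topologicalType)
    (phi : Cplx R -> Y) (Psi : Cplx R -> Cplx R) (X : set (Cplx R))
    (F : set (set (Cplx R) * set (Cplx R))) :
  plane_continuum Q -> unshielded Q -> riemann_map Q Psi ->
  finest_map Q phi ->
  plane_continuum X -> X `<=` Q ->
  well_slicing Q Psi X F ->
  ~ (exists y : Y, phi @` X = [set y]).
Proof.
move=> [Q0 cQ kQ] uQ rPsi [_ _ _ univ] [_ _ kX] XQ wF [y0 phiX].
have [f [cf [x [y [Xx Xy fxy]]] fimp]] := well_slicing_function cQ uQ rPsi kX XQ wF.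
have cS : compact [set w : Cplx R | normc w = 1].
  apply: (subclosed_compact _ (@compact_disc R 1)); last by move=> w /= ->.
  rewrite (_ : [set w | _] = (@normc R : Cplx R -> R) @^-1` [set 1])//.
  by apply: closed_comp => [? _|]; [exact: normc_continuous|exact: closed_eq].
have [Z [g [lcZ mg gQ gf]]] := locally_connected_quotient cQ kQ Q0 cf cS
  (fun w => @impression_nonempty _ _ _ rPsi w) (fun w => @impression_connected _ _ _ cQ uQ rPsi w)
  (fun w => @impression_sub _ _ _ uQ rPsi w) fimp (impression_cover uQ rPsi)
  (fun w x _ h => impression_closed_graph (fun A B wA xB =>
     let: ex_intro w' (And3 _ Aw' wB) := h A B wA xB in ex_intro2 _ _ w' Aw' wB))
  (fun w A => @arc_basis R w A).
(* On [Q], [g] is [h] after [phi]; if [phi] collapsed [X], then [g x = g y], hence [f x = f y]. *)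
have [h [_ gh]] := univ Z g lcZ mg gQ.
apply: fxy; apply: gf; [exact: XQ|exact: XQ|].
rewrite !gh ?inE; [|exact: XQ|exact: XQ]; congr h.
have phi0 z : X z -> phi z = y0.
  by move=> Xz; have : (phi @` X) (phi z) by [exists z]; rewrite phiX.
by rewrite !phi0.
Qed.
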